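(* Let $n\le 110$ and let $X(R_1,R_2)$ be a skew-symmetric circulant $D$-optimal design of order $n$ meeting the bound $\det M\le (2n-2)(n-2)^{(n-2)/2}$. Then $X(R_1,R_2)$ is equivalent to one of the designs $D_6$, $D_{14}$, $D_{26}$, $D_{42}$, $D_{62}$, where $D_{2v}$ is the circulant $D$-optimal design of order $2v$ corresponding to the following supplementary difference set $(A,B)$ over $\mathbb{Z}_v$: $D_6$ ($v=3$): $A=\{2\}$, $B=\emptyset$. $D_{14}$ ($v=7$): $A=\{3,5,6\}$, $B=\{0\}$. $D_{26}$ ($v=13$): $A=\{4,7,8,10,11,12\}$, $B=\{0,2,8\}$. $D_{42}$ ($v=21$): $A=\{2,3,9,11,13,14,15,16,17,20\}$, $B=\{0,1,7,9,12,17\}$. $D_{62}$ ($v=31$): $A=\{4,6,7,12,16,17,18,20,21,22,23,26,28,29,30\}$, $B=\{0,1,4,5,8,11,16,18,20,29\}$.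
   Context: A $D$-optimal design of order $n$ is an $n\times n$ $(1,-1)$-matrix having maximum determinant. For $n\equiv 2\pmod 4$, $n>2$, every $n\times n$ $(1,-1)$-matrix $M$ satisfies $\det M\le (2n-2)(n-2)^{(n-2)/2}$ (Ehlich). Let $n=2v\equiv 2\pmod 4$, $n>2$. If $R_1,R_2$ are circulant $v\times v$ $(1,-1)$-matrices with $R_1R_1^T+R_2R_2^T=(2v-2)I+2J$ ($J$ the all-one matrix), then $$X(R_1,R_2)=\begin{pmatrix}R_1&R_2\\-R_2^T&R_1^T\end{pmatrix}$$ is a $D$-optimal design attaining this bound, and it is called a circulant $D$-optimal design of order $n$ meeting the bound. A $(1,-1)$-matrix $M$ is called skew-symmetric if $M-I=-(M-I)^T$. Let $\mathbb{Z}_v=\{0,1,\ldots,v-1\}$ be the ring of integers modulo $v$. For $A\subset\mathbb{Z}_v$ let $P_A(i)=|\{(x,y)\in A\times A\mid y-x=i\}|$ and $P_A=(P_A(1),\ldots,P_A(v-1))$. For an $r$-subset $A$ and a $k$-subset $B$ of $\mathbb{Z}_v$, $(A,B)$ is a $2$-$\{v;r,k;\lambda\}$ supplementary difference set if $P_A+P_B=(\lambda,\ldots,\lambda)$. Pairs $(A,B)$ of subsets of $\mathbb{Z}_v$ correspond to pairs $(R_1,R_2)$ of circulant $v\times v$ $(1,-1)$-matrices as follows: the first row $(r_{1,1},\ldots,r_{1,v})$ of $R_1$ has $r_{1,i+1}=-1$ if $i\in A$ and $1$ if $i\notin A$, and the first row $(r_{2,1},\ldots,r_{2,v})$ of $R_2$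 has $r_{2,i+1}=-1$ if $i\in B$ and $1$ if $i\notin B$. Under this correspondence, $(A,B)$ is a $2$-$\{v;r,k;r+k-(v-1)/2\}$ supplementary difference set if and only if $X(R_1,R_2)$ is a circulant $D$-optimal design of order $2v$ meeting the bound (Chadjipantelis and Kounias); this is the meaning of ''corresponding''. Equivalence of supplementary difference sets over $\mathbb{Z}_v$ is the equivalence relation generated by declaring $(A,B)$ equivalent to each of: (E0) $(\mathbb{Z}_v\setminus A,B)$ and $(A,\mathbb{Z}_v\setminus B)$; (E1) $(B,A)$; (E2) $(\pm A+a,\pm B+b)$ for any $a,b\in\mathbb{Z}_v$ (signs chosen independently); (E3) $(dA,dB)$ for any $d\in\{1,\ldots,v-1\}$ with $\gcd(d,v)=1$. Two circulant $D$-optimal designs meeting the bound are called equivalent if the corresponding supplementary difference sets are equivalent. *)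

(* Defs.v *)
From Stdlib Require Import Relation_Operators.
From mathcomp Require Import all_boot all_order all_algebra.

Set Implicit Arguments.
Unset Strict Implicit.
Unset Printing Implicit Defensive.

Import GRing.Theory.
Local Open Scope ring_scope.

(* 'Z_v is used with 1 < v only ('Z_0 and 'Z_1
   both denote the integers mod 2). *)

Definition pm1_mx (m n : nat) (M : 'M[int]_(m, n)) : Prop :=
  forall i j, M i j = 1 \/ M i j = -1.

(* ordS is the successor modulo v. *)
Definition circulant (v : nat) (R : 'M[int]_v) : Prop :=
  forall i j, R (ordS i) (ordS j) = R i j.

Definition skew_symmetric (n : nat) (M : 'M[int]_n) : Prop :=
  M - 1%:M = - (M - 1%:M)^T.

Definition Xmx (v : nat) (R1 R2 : 'M[int]_v) : 'M[int]_(v + v) :=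
  block_mx R1 R2 (- R2^T) R1^T.

(* For odd v > 1, with n = 2v, this Gram identity is what defines Xmx R1 R2 to
   be a circulant D-optimal design of order n meeting the bound; it forces
   \det (Xmx R1 R2) = (2n - 2) (n - 2)^((n - 2) / 2), the maximum of the
   determinant over n x n (1,-1)-matrices. *)
Definition circulant_Dopt (v : nat) (R1 R2 : 'M[int]_v) : Prop :=
  [/\ pm1_mx R1 /\ pm1_mx R2, circulant R1 /\ circulant R2 &
      R1 *m R1^T + R2 *m R2^T = (2 * v%:R - 2)%:M + 2 *: const_mx 1].

Definition diff_count (v : nat) (A : {set 'Z_v}) (i : 'Z_v) : nat :=
  #|[set xy in setX A A | xy.2 - xy.1 == i]|.

Definition is_sds (v r k l : nat) (A B : {set 'Z_v}) : Prop :=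
  [/\ #|A| = r, #|B| = k &
      forall i : 'Z_v, i != 0 -> (diff_count A i + diff_count B i)%N = l].

(* l = r + k - (v - 1) / 2, stated without truncated subtraction. *)
Definition Dopt_sds (v : nat) (A B : {set 'Z_v}) : Prop :=
  exists r k l : nat,
    is_sds r k l A B /\ (l + (v.-1)./2 = r + k)%N.

Inductive sds_step (v : nat) :
    {set 'Z_v} * {set 'Z_v} -> {set 'Z_v} * {set 'Z_v} -> Prop :=
  | SdsComplL A B : sds_step (A, B) (~: A, B)
  | SdsComplR A B : sds_step (A, B) (A, ~: B)
  | SdsSwap A B : sds_step (A, B) (B, A)
  | SdsAffine (s t : bool) (a b : 'Z_v) A B :
      sds_step (A, B) ([set (-1) ^+ s * x + a | x in A],
                       [set (-1) ^+ t * y + b | y in B])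
  | SdsMult (d : nat) A B :
      (0 < d < v)%N -> coprime d v ->
      sds_step (A, B) ([set d%:R * x | x in A], [set d%:R * y | y in B]).

(* Every generating step preserves Dopt_sds in both directions, so generating
   on all pairs of subsets and then restricting to supplementary difference
   sets gives the same relation as generating on the latter only. *)
Definition sds_equiv (v : nat) :
    {set 'Z_v} * {set 'Z_v} -> {set 'Z_v} * {set 'Z_v} -> Prop :=
  clos_refl_sym_trans _ (@sds_step v).

(* The circulant matrix whose first row has -1 exactly at the positions
   (counted from 0) that lie in A. *)
Definition circ_mx (v : nat) (A : {set 'Z_v}) : 'M[int]_v :=
  \matrix_(i, j) if (j%:R - i%:R : 'Z_v) \in A then -1 else 1.

Definition sds_design (v : nat) (A B : {set 'Z_v}) : 'M[int]_(v + v) :=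
  Xmx (circ_mx A) (circ_mx B).

(* The order is an index of the family: only designs of equal order can be
   equivalent. *)
Inductive design_equiv (v : nat) :
    'M[int]_(v + v) -> forall w : nat, 'M[int]_(w + w) -> Prop :=
  | DesignEquiv (A B A' B' : {set 'Z_v}) :
      Dopt_sds A B -> Dopt_sds A' B' -> sds_equiv (A, B) (A', B') ->
      @design_equiv v (sds_design A B) v (sds_design A' B').

Definition D6 : 'M[int]_(3 + 3) := @sds_design 3 [set 2] set0.

Definition D14 : 'M[int]_(7 + 7) := @sds_design 7 [set 3; 5; 6] [set 0].

Definition D26 : 'M[int]_(13 + 13) :=
  @sds_design 13 [set 4; 7; 8; 10; 11; 12] [set 0; 2; 8].

Definition D42 : 'M[int]_(21 + 21) :=
  @sds_design 21 [set 2; 3; 9; 11; 13; 14; 15; 16; 17; 20]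
                 [set 0; 1; 7; 9; 12; 17].

Definition D62 : 'M[int]_(31 + 31) :=
  @sds_design 31
    [set 4; 6; 7; 12; 16; 17; 18; 20; 21; 22; 23; 26; 28; 29; 30]
    [set 0; 1; 4; 5; 8; 11; 16; 18; 20; 29].

(* Main.v *)
(* Skew-symmetry of X(R1, R2) says that A is skew: Z_v \ {0} is the disjoint
   union of A and -A, so |A| = (v - 1) / 2.  Counting differences then gives
   lambda = k = |B| (up to complementing B) and 4v - 3 = (v - 2k)^2, hence
   v = 3, 7, 13, 21, 31 or 43.  For a nontrivial character z of Z_v the
   eigenvalues of R1 - I and R2 satisfy |s(z)|^2 + |g(z)|^2 = 2v - 3, so all the
   |s(z)| are at most sqrt(2v - 3).  These bounds, tested through integer
   approximations of cosines and sines, leave very few skew sets up to dilation: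
   the listed A, the nonzero squares for v = 31 and 43, and one further set for
   v = 43. Then A prescribes how often each difference occurs in B. For v <= 31
   a backtracking search finds all B. For v = 43 there is none: with A the
   squares, B would be a cyclic (43, 15, 5) difference set, which is excluded
   modulo 2 because -1 is a power of 2; with the other A, |B(z)|^2 has odd
   valuation at a place of the real subfield over 39301, which is inert in Q(z)
   since 39301 = -1 mod 43. *)

Require Import Defs.
From Stdlib Require Import Relation_Operators NArith ZArith.
From Stdlib Require Znumtheory.
From mathcomp Require Import all_boot all_order all_algebra.
From mathcomp Require Import zify ssrZ ring qpoly.

Set Implicit Arguments.
Unset Strict Implicit.
Unset Printing Implicit Defensive.

Import Order.TTheory GRing.Theory Num.Theory.
Local Open Scope ring_scope.

(** * Autocorrelations of skew pairs *)

Definition skew_set (v : nat) (A : {set 'Z_v}) : Prop :=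
  0 \notin A /\ forall x, x != 0 -> (- x \in A) = (x \notin A).

(** A skew A has (v - 1) / 2 elements, so lambda = |A| + k - (v - 1) / 2 is k itself. *)
Definition skew_pair (v k : nat) (A B : {set 'Z_v}) : Prop :=
  [/\ skew_set A, #|B| = k &
      forall d, d != 0 -> (diff_count A d + diff_count B d = k)%N].

Lemma diff_countE (v : nat) (A : {set 'Z_v}) d :
  diff_count A d = #|[set x in A | x + d \in A]|.
Proof.
rewrite /diff_count -(@card_in_imset _ _ (fun xy : 'Z_v * 'Z_v => xy.1)).
  apply: eq_card => x; apply/imsetP/idP.
    case=> -[a b]; rewrite !inE /= => /andP[/andP[aA bA] /eqP dE] ->.
    by rewrite aA -dE addrC subrK.
  rewrite inE => /andP[xA xdA]; exists (x, x + d) => //.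
  by rewrite !inE /= xA xdA addrC addKr /=.
move=> [a b] [a' b']; rewrite !inE /= => /andP[_ /eqP h1] /andP[_ /eqP h2] e.
by congr pair => //; apply: (@addIr _ (- a)); rewrite h1 e h2.
Qed.

Lemma diff_count0 (v : nat) (A : {set 'Z_v}) : diff_count A 0 = #|A|.
Proof.
by rewrite diff_countE; apply: eq_card => x;
  rewrite !inE addr0 andbb.
Qed.

Section Correlations.
Variables (v' : nat).
Local Notation v := v'.+2.
Implicit Types (A B : {set 'Z_v}) (x y d : 'Z_v) (s g u w : 'Z_v -> Z).

(** Up to a global sign this is the first row of [circ_mx A]; for A without 0, [ssgn A] is likewise
    the first row of R1 - I. *)
Definition psgn A x : Z := if x \in A then 1 else -1.
Definition ssgn A x : Z := if x == 0 then 0 else psgn A x.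

Lemma sum_mem_card (R : pzRingType) A : \sum_x ((x \in A)%:R : R) = #|A|%:R.
Proof.
rewrite -sum1_card natr_sum [RHS]big_mkcond /=.
by apply: eq_bigr => x _; case: (x \in A).
Qed.

Lemma corr_psgn A d :
  \sum_x psgn A x * psgn A (x + d)
    = v%:R - 4 * #|A|%:R + 4 * (diff_count A d)%:R.
Proof.
have fE x : psgn A x = 2 * (x \in A)%:R - 1 by rewrite /psgn; case: ifP.
have -> : v%:R = \sum_(x : 'Z_v) (1 : Z).
  by rewrite sumr_const card_ord.
under eq_bigr do rewrite !fE.
have shift : \sum_x ((x + d \in A)%:R : Z) = #|A|%:R.
  by rewrite -sum_mem_card [RHS](reindex_inj (addIr d)).
have -> : (diff_count A d)%:R = \sum_x ((x \in A)%:R * (x + d \in A)%:R : Z).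
  rewrite diff_countE -sum_mem_card; apply: eq_bigr => x _.
  by rewrite inE; do 2 case: (_ \in A).
transitivity (\sum_x (1 - 2 * (x \in A)%:R - 2 * (x + d \in A)%:R
   + 4 * ((x \in A)%:R * (x + d \in A)%:R)) : Z).
  by apply: eq_bigr => x _; ring.
rewrite !big_split /= !sumrN -!mulr_sumr shift sum_mem_card; ring.
Qed.

Hypothesis odd_v : odd v.

Lemma card_skew_set A : skew_set A -> #|A| = v./2.
Proof.
case=> A0 Ask.
have negA : [set - x | x in A] = ~: (0 |: A).
  apply/setP => x; rewrite !inE negb_or -[x in LHS]opprK mem_imset ?inE;
    last exact: oppr_inj.
  by have [->|/Ask->//] := eqVneq x 0; rewrite oppr0 (negbTE A0).
have := cardsC (0 |: A); rewrite -negA card_imset; last exact: oppr_inj.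
rewrite cardsU1 A0 card_ord => e.
have : (1 + #|A| + #|A| = v)%N by exact: e.
lia.
Qed.

(** Putting 0 in place of the entry at 0 changes the autocorrelation of [psgn A] by the signs at d
    and -d, which cancel for d nonzero because A is skew. In characters: |s(z)|^2 + |g(z)|^2 = 2v -
    3 at every nontrivial z. *)
Lemma corr_skew_pair k A B d : skew_pair k A B ->
  \sum_x ssgn A x * ssgn A (x + d) + \sum_x psgn B x * psgn B (x + d)
    = 2 + (d == 0)%:R * (2 * v - 3)%:R.
Proof.
move=> [skA Bk AB]; have [A0 Ask] := skA; have rA := card_skew_set skA.
have sE x : ssgn A x = psgn A x + (x == 0)%:R.
  rewrite /ssgn; case: eqP => [->|_]; last by rewrite addr0.
  by rewrite /psgn (negbTE A0).
have -> : \sum_x ssgn A x * ssgn A (x + d) =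
  \sum_x psgn A x * psgn A (x + d) + psgn A (- d) + psgn A d + (d == 0)%:R.
  have pick1 (F : 'Z_v -> Z) y : \sum_x F x * (x == y)%:R = F y.
    rewrite (bigD1 y) //= eqxx mulr1 big1 ?addr0 // => x /negbTE->.
    by rewrite mulr0.
  transitivity (\sum_x (psgn A x * psgn A (x + d) + psgn A x * (x == - d)%:R
     + (psgn A (x + d) * (x == 0)%:R + (x + d == 0)%:R * (x == 0)%:R)) : Z).
    apply: eq_bigr => x _; rewrite !sE -[x == - d]addr_eq0; ring.
  by rewrite !big_split /= !pick1 !add0r !addrA.
rewrite !corr_psgn Bk rA.
have [->|d0] := eqVneq d 0.
  rewrite oppr0 !diff_count0 rA Bk /psgn (negbTE A0); lia.
have -> : psgn A d = - psgn A (- d).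
  by rewrite /psgn Ask //; case: (d \in A).
have := AB d d0; lia.
Qed.

(* Nonnegativity of [sum (s * w - u)^2 + sum (g * w)^2], where [*] is the cyclic
   convolution.  It is nearly tight when [w] and [u] approximate a cosine and a
   suitably scaled sine of the same frequency. *)
Lemma corr_bound (c : Z) s g u w :
    (forall d, \sum_x s x * s (x + d) + \sum_x g x * g (x + d)
       = 2 + (d == 0)%:R * c) ->
  2 * \sum_y s y * \sum_x u x * w (x - y)
    <= 2 * (\sum_x w x) ^+ 2 + c * \sum_x w x ^+ 2 + \sum_x u x ^+ 2.
Proof.
move=> sg.
pose conv f x := \sum_y f y * w (x - y) : Z.
(* The energy of a convolution is the pairing of the two autocorrelations. *)
have convE f : \sum_x conv f x ^+ 2 =
    \sum_d (\sum_x w x * w (x + d)) * (\sum_x f x * f (x + d)).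
  transitivity (\sum_x \sum_y \sum_z f y * f z * (w (x - y) * w (x - z))).
    apply: eq_bigr => x _; rewrite expr2 /conv mulr_suml; apply: eq_bigr => y _.
    by rewrite mulr_sumr; apply: eq_bigr => z _; rewrite mulrACA.
  rewrite exchange_big; under eq_bigr do rewrite exchange_big /=.
  under eq_bigr do under eq_bigr do rewrite -mulr_sumr.
  transitivity (\sum_y \sum_d f y * f (y + d) * \sum_x w x * w (x + d)).
    apply: eq_bigr => y _; rewrite (reindex_inj (addrI y)) /=.
    apply: eq_bigr => d _; congr (_ * _).
    rewrite (reindex_inj (addIr (y + d))) /=; apply: eq_bigr => x _.
    by rewrite addrK mulrC; congr (_ * w _); rewrite (addrC y) addrA addrK.
  rewrite exchange_big; apply: eq_bigr => d _.
  by rewrite -mulr_suml mulrC.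
(* The constant term 2 contributes the squared sum of [w], the peak at d = 0 its energy. *)
have tot : \sum_x conv s x ^+ 2 + \sum_x conv g x ^+ 2 =
    2 * (\sum_x w x) ^+ 2 + c * \sum_x w x ^+ 2.
  rewrite !convE -big_split /=.
  under eq_bigr do rewrite -mulrDr sg mulrDr.
  rewrite big_split /=; congr (_ + _).
    rewrite -mulr_suml mulrC exchange_big /= expr2 mulr_suml; congr (_ * _).
    apply: eq_bigr => x _; rewrite -mulr_sumr; congr (_ * _).
    by rewrite [RHS](reindex_inj (addrI x)).
  rewrite (bigD1 0) //= mul1r [X in _ + X]big1 => [|d d0].
    rewrite addr0 mulrC; congr (_ * _); apply: eq_bigr => x _.
    by rewrite addr0 expr2.
  by rewrite (negbTE d0) mul0r mulr0.
have cross : \sum_y s y * \sum_x u x * w (x - y) = \sum_x u x * conv s x.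
  under eq_bigr do rewrite mulr_sumr.
  rewrite exchange_big; apply: eq_bigr => x _; rewrite mulr_sumr.
  by apply: eq_bigr => y _; rewrite mulrCA.
rewrite cross -tot.
have ge0 : 0 <= \sum_x (conv s x - u x) ^+ 2 + \sum_x conv g x ^+ 2.
  by rewrite addr_ge0 ?sumr_ge0 // => x _; exact: sqr_ge0.
rewrite -subr_ge0; apply: le_trans ge0 _; rewrite le_eqVlt; apply/orP; left;
  apply/eqP.
have -> : \sum_x (conv s x - u x) ^+ 2 =
   \sum_x conv s x ^+ 2 - 2 * (\sum_x u x * conv s x) + \sum_x u x ^+ 2.
  rewrite mulr_sumr -sumrN -!big_split /=; apply: eq_bigr => x _; ring.
ring.
Qed.

End Correlations.

(** * Dilations, affine maps and complements *)

Section Moves.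
Variables (v' : nat).
Local Notation v := v'.+2.
Implicit Types (A B : {set 'Z_v}) (x y d : 'Z_v).

Lemma diff_count_imset A (f c : 'Z_v -> 'Z_v) d : injective f ->
  (forall x, f (x + d) = f x + c d) ->
  diff_count [set f x | x in A] (c d) = diff_count A d.
Proof.
move=> finj fc; rewrite !diff_countE -[RHS](card_imset _ finj).
apply: eq_card => y; apply/idP/imsetP.
  rewrite inE => /andP[/imsetP[x xA ->]]; rewrite -fc mem_imset // => xdA.
  by exists x; rewrite // inE xA.
case=> x /[!inE] /andP[xA xdA] ->.
by rewrite -fc !mem_imset // xA.
Qed.

(** Complementing negates [psgn], so both sets have the same autocorrelation. *)
Lemma diff_countC B d :
  (diff_count (~: B) d + 2 * #|B| = v + diff_count B d)%N.
Proof.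
have := corr_psgn (~: B) d; have := corr_psgn B d.
have -> : \sum_x psgn (~: B) x * psgn (~: B) (x + d) =
  \sum_x psgn B x * psgn B (x + d).
  by apply: eq_bigr => x _; rewrite /psgn !inE; do 2 case: (_ \in B).
have : (#|B| + #|~: B| = v)%N by rewrite cardsC card_ord.
lia.
Qed.

Definition dilate m A : {set 'Z_v} := [set m%:R * x | x in A].

Lemma mulZ_inj m : coprime m v -> injective ( *%R (m%:R : 'Z_v)).
Proof.
by move=> cm; apply: mulrI; rewrite unitZpE // coprime_sym.
Qed.

Lemma skew_pair_dilate m k A B : coprime m v ->
  skew_pair k A B -> skew_pair k (dilate m A) (dilate m B).
Proof.
move=> cm [[A0 Ask] Bk AB]; have minj := mulZ_inj cm.
have [g mg] : bijective ( *%R (m%:R : 'Z_v)) by exact: injF_bij.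
move=> gm; split; first split.
- apply/imsetP => -[x xA /eqP]; rewrite -[X in X == _](mulr0 (m%:R : 'Z_v)).
  by rewrite (inj_eq minj) => /eqP e; rewrite e xA in A0.
- move=> x; rewrite -[x]gm; move: (g x) => y.
  rewrite -[0](mulr0 (m%:R : 'Z_v)) (inj_eq minj) -mulrN !mem_imset //.
  exact: Ask.
- by rewrite card_imset.
- move=> d; rewrite -[d]gm; move: (g d) => e.
  rewrite -[0](mulr0 (m%:R : 'Z_v)) (inj_eq minj) => /AB <-.
  by congr addn; apply: diff_count_imset => // x; rewrite mulrDr.
Qed.

(** Only B moves. Its differences are multiplied by the sign, so it is needed that the counts of A
    are even in d; translation by -d shows this. *)
Lemma skew_pair_affine (s : bool) (t : 'Z_v) k A B :
  skew_pair k A B -> skew_pair k A [set (-1) ^+ s * y + t | y in B].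
Proof.
move=> [skA Bk AB]; pose c (x : 'Z_v) := (-1) ^+ s * x.
have cK : involutive c.
  by move=> x; rewrite /c mulrA -expr2 sqrr_sign mul1r.
have finj : injective (fun y : 'Z_v => (-1) ^+ s * y + t).
  by move=> x y /addIr /(can_inj cK).
split=> // [|d d0]; first by rewrite card_imset.
have AE : diff_count A (c d) = diff_count A d.
  rewrite /c; case: s {finj c cK}; rewrite ?expr0 ?mul1r // expr1 mulN1r.
  rewrite !diff_countE -(card_imset _ (addIr (- d))); apply: eq_card => x.
  apply/imsetP/idP => [[y]|].
    by move=> /[!inE] /andP[yA ydA] ->; rewrite subrK yA ydA.
  rewrite inE => /andP[xA xdA].
  by exists (x + d); rewrite ?addrK // inE addrK xA xdA.
have := AB (c d); rewrite AE -(AB d) // => <-.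
  by congr addn; rewrite -[d in LHS]cK;
     apply: diff_count_imset => // x; rewrite /c mulrDr addrAC.
by rewrite -[0](cK 0) (inj_eq (can_inj cK)) /c mulr0.
Qed.

Lemma skew_pair_Dopt k A B : odd v -> skew_pair k A B -> Dopt_sds A B.
Proof.
move=> vo [skA Bk AB]; exists #|A|, k, k; split; first by split.
rewrite card_skew_set //; lia.
Qed.

End Moves.

(** * From designs to pairs of sets *)

Section FromDesigns.
Variables (v' : nat).
Local Notation v := v'.+2.
Implicit Types (A B : {set 'Z_v}) (R : 'M[int]_v).

Definition neg_set R : {set 'Z_v} := [set a : 'Z_v | R 0 a == -1].

Lemma ordS_Zp (x : 'Z_v) : ordS x = x + 1.
Proof. by apply/val_inj => /=; rewrite modnDmr addn1. Qed.

Lemma circulant_circ_mx R : pm1_mx R -> circulant R -> R = circ_mx (neg_set R).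
Proof.
move=> pR cR; have shift (i j k : 'Z_v) : R (i + k) (j + k) = R i j.
  rewrite -[k]natr_Zp; elim: (nat_of_ord k) => [|n IHn];
    first by rewrite !addr0.
  by rewrite -IHn -(cR (i + n%:R)) !ordS_Zp -!addrA natr1.
apply/matrixP => i j; rewrite mxE inE !natr_Zp.
rewrite -{1}[i]add0r -{1}[j](subrK i) shift.
by case: (pR 0 (j - i)) => ->.
Qed.

Lemma circ_mxE B (i j : 'Z_v) : circ_mx B i j = if j - i \in B then -1 else 1.
Proof. by rewrite mxE !natr_Zp. Qed.

Lemma circ_corr B (d : 'Z_v) :
  (circ_mx B *m (circ_mx B)^T) 0 d
    = v%:R - 4 * #|B|%:R + 4 * (diff_count B d)%:R.
Proof.
rewrite mxE.
have sumB (C : {set 'Z_v}) : \sum_(x : 'Z_v) ((x \in C)%:R : int) = #|C|%:R.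
  exact: sum_mem_card.
have -> : v%:R = \sum_(x : 'Z_v) (1 : int) by rewrite sumr_const card_ord.
have shift : \sum_(x : 'Z_v) ((x + d \in B)%:R : int) = #|B|%:R.
  by rewrite -sumB [RHS](reindex_inj (addIr d)).
have -> : (diff_count B d)%:R
    = \sum_(x : 'Z_v) ((x \in B)%:R * (x + d \in B)%:R : int).
  rewrite diff_countE -sumB; apply: eq_bigr => x _.
  by rewrite inE; do 2 case: (_ \in B).
rewrite (reindex_inj (addIr d)) /=.
transitivity (\sum_(x : 'Z_v) (1 - 2 * (x \in B)%:R - 2 * (x + d \in B)%:R
   + 4 * ((x \in B)%:R * (x + d \in B)%:R)) : int).
  apply: eq_bigr => x _; rewrite [X in _ * X]mxE !circ_mxE subr0 addrK.
  by do 2 case: (_ \in B).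
rewrite !big_split /= !sumrN -!mulr_sumr shift sumB; ring.
Qed.

Lemma skew_circ_mx A R : skew_symmetric (Xmx (circ_mx A) R) -> skew_set A.
Proof.
rewrite /skew_symmetric /Xmx => /matrixP sk.
have sk' (x : 'Z_v) : (if x \in A then -1 else 1 : int) - (x == 0)%:R
   = - ((if - x \in A then -1 else 1) - (x == 0)%:R).
  have := sk (lshift v (0 : 'Z_v)) (lshift v x).
  rewrite [LHS]mxE [RHS]mxE [X in _ = - X]mxE [X in _ = - X]mxE !block_mxEul.
  rewrite !circ_mxE !mxE !(inj_eq (@lshift_inj _ _)) subr0 sub0r.
  by rewrite (eq_sym (0 : 'Z_v)).
split; first by have := sk' 0; rewrite oppr0 eqxx; case: (0 \in A).
by move=> x /negbTE x0; have := sk' x; rewrite x0; do 2 case: (_ \in A).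
Qed.

Lemma design_diff_count A B : odd v ->
    circulant_Dopt (circ_mx A) (circ_mx B) -> skew_set A ->
  forall d, d != 0 -> (diff_count A d + diff_count B d = #|B|)%N.
Proof.
move=> vo [_ _ /matrixP gram] skA d d0.
have := gram 0 d; rewrite [in RHS]mxE mxE !circ_corr [in RHS]mxE !mxE.
rewrite eq_sym (negbTE d0) mulr0n add0r mulr1 (card_skew_set vo skA).
have : (v = v./2.*2 + 1)%N by rewrite -[LHS]odd_double_half vo addnC.
lia.
Qed.

(** Counting all differences of A and B gives h^2 + k^2 = h + k + 2hk with h = (v - 1) / 2, that is
    (h - k)^2 = h + k. Under truncated subtraction at most one of the two squares is nonzero. *)
Lemma skew_pair_params k A B : odd v -> skew_pair k A B ->
  ((v./2 - k) ^ 2 + (k - v./2) ^ 2 = v./2 + k)%N.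
Proof.
move=> vo [skA Bk AB]; have rA := card_skew_set vo skA.
have : (v = v./2.*2 + 1)%N by rewrite -[LHS]odd_double_half vo addnC.
move: (v./2) rA => h rA vE; have v1E : v'.+1 = h.*2 by lia.
have sumP (C : {set 'Z_v}) : (\sum_d diff_count C d = #|C| * #|C|)%N.
  transitivity (\sum_d \sum_(x in C) ((x + d)%R \in C : nat))%N.
    apply: eq_bigr => d _;
      rewrite diff_countE -sum1_card big_mkcond [RHS]big_mkcond.
    by apply: eq_bigr => x _; rewrite inE; do 2 case: (_ \in C).
  rewrite exchange_big /= -sum_nat_const; apply: eq_bigr => x _.
  rewrite -[RHS]sum1_card [RHS]big_mkcond [RHS](reindex_inj (addrI x)) /=.
  by apply: eq_bigr => d _; case: (_ \in C).
have := congr2 addn (sumP A) (sumP B); rewrite -big_split /=.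
rewrite (bigD1 0) //= !diff_count0 (eq_bigr (fun _ => k)) => [|d d0];
  last exact: AB.
rewrite sum_nat_const cardC1 card_ord rA Bk /=.
change (Zp_trunc v) with v'.
rewrite /= v1E -!mulnn => e.
case: (leqP h k) => hk.
  have [j jE] : exists j, k = (h + j)%N by exists (k - h)%N; rewrite subnKC.
  move: e; rewrite jE; have -> : (h - (h + j) = 0)%N by lia.
  have -> : (h + j - h = j)%N by lia.
  nia.
have [j jE] : exists j, h = (k + j)%N by exists (h - k)%N;
  rewrite subnKC // ltnW.
move: e; rewrite jE; have -> : (k - (k + j) = 0)%N by lia.
have -> : (k + j - k = j)%N by lia.
nia.
Qed.

End FromDesigns.

(** * Search for the skew set *)

(** One pass of [Pos.sub_mask] both compares and subtracts. *)
Definition spend1 (b c : N) : option N :=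
  match c, b with
  | N0, _ => Some b
  | Npos _, N0 => None
  | Npos q, Npos p =>
      match Pos.sub_mask p q with
      | Pos.IsPos r => Some (Npos r)
      | Pos.IsNul => Some N0
      | Pos.IsNeg => None
      end
  end.

Fixpoint spend (bs cs : seq N) : option (seq N) :=
  match bs, cs with
  | b :: bs', c :: cs' =>
      match spend1 b c with
      | None => None
      | Some b' =>
          match spend bs' cs' with None => None | Some r => Some (b' :: r) end
      end
  | _, _ => Some [::]
  end.

(** Depth-first search over sign vectors. A column holds, for every row, the costs of a positive and
    of a negative sign; a branch is dropped when a budget is overspent or [good] fails, and all
    surviving leaves must pass [leaf]. *)
Fixpoint explore (good leaf : seq bool -> bool) (cols : seq (seq N * seq N))
    (bs : seq N) (path : seq bool) : bool :=
  match cols with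
  | [::] => leaf path
  | (p, n) :: cols' =>
      (if good (true :: path) then
         match spend bs p with
         | None => true
         | Some b => explore good leaf cols' b (true :: path)
         end
       else true) &&
      (if good (false :: path) then
         match spend bs n with
         | None => true
         | Some b => explore good leaf cols' b (false :: path)
         end
       else true)
  end.

Lemma spend1P b c : spend1 b c = if N.leb c b then Some (b - c)%num else None.
Proof.
case: b c => [|p] [|q] //=.
have -> : N.leb (N.pos q) (N.pos p) = if Pos.compare p q is Lt then false else
  true.
  by case: Pos.compare_spec => pq; case: N.leb_spec => //; lia.
rewrite Pos.compare_sub_mask; change PosDef.Pos.sub_mask with Pos.sub_mask.
by case: (Pos.sub_mask p q).
Qed.

Lemma spend_map (T : eqType) (rows : seq T) (b c : T -> N) :
    {in rows, forall r, N.le (c r) (b r)} ->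
  spend (map b rows) (map c rows) = Some [seq (b r - c r)%num | r <- rows].
Proof.
elim: rows => //= r rows IH cb; rewrite spend1P.
have /N.leb_le-> := cb r (mem_head _ _); rewrite IH // => x xr.
by apply: cb; rewrite inE xr orbT.
Qed.

(** Costs are nonnegative, so if the total costs of [s] fit the budgets, then so do all partial
    ones: the branch of [s] is never dropped and its leaf is tested. *)
Lemma explore_sound (T J : eqType) (rows : seq T) (cost : T -> J -> bool -> N)
    (good leaf : seq bool -> bool) (js : seq J) b path (s : J -> bool) :
    explore good leaf
      [seq ([seq cost r j true | r <- rows], [seq cost r j false | r <- rows])
         | j <- js] (map b rows) path ->
    {in rows, forall r,
      \sum_(j <- js) Z.of_N (cost r j (s j)) <= Z.of_N (b r)} ->
    (forall i, (i <= size js)%N -> good (catrev (map s (take i js)) path)) ->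
  leaf (catrev (map s js) path).
Proof.
elim: js b path => [|j js IH] b path //= /andP[et ef] fits gd.
have g1 : good (s j :: path) by have := gd 1%N isT; rewrite /= take0.
have le1 r : r \in rows -> N.le (cost r j (s j)) (b r).
  move=> /fits; rewrite big_cons => le_b.
  have ge0 : 0 <= \sum_(i <- js) Z.of_N (cost r i (s i)).
    by apply: sumr_ge0 => i _; lia.
  by move: (\sum_(i <- js) _) ge0 le_b => t; lia.
have step : explore good leaf
      [seq ([seq cost r j true | r <- rows], [seq cost r j false | r <- rows])
         | j <- js] [seq (b r - cost r j (s j))%num | r <- rows] (s j :: path).
  by case: (s j) g1 le1 => g1 /spend_map sE; move: et ef; rewrite g1 sE.
apply: IH step _ _ => [r rr|i ile].
  have := fits r rr; rewrite big_cons; have := le1 r rr.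
  by move: (\sum_(i <- js) _) => t; lia.
exact: (gd i.+1).
Qed.

Definition zsum (l : seq Z) : Z := foldr Z.add Z0 l.

Lemma zsumE (T : Type) (F : T -> Z) (l : seq T) :
  zsum (map F l) = \sum_(i <- l) F i.
Proof. by elim: l => [|i l IH] /=; rewrite ?big_nil // big_cons -IH. Qed.

Section Tests.
Variable v : nat.

Definition cross (u w : seq Z) (y : nat) : Z :=
  zsum [seq nth 0 u i * nth 0 w ((i + (v - y)) %% v) | i <- iota 0 v].

(** The sign vector of a skew set is odd, so the values at y and -y merge into one coefficient for
    the sign at y. *)
Definition tilt (u w : seq Z) : seq Z :=
  [seq cross u w y - cross u w (v - y) | y <- iota 0 v].

Definition sumsq (l : seq Z) : Z :=
  zsum [seq nth 0 l i * nth 0 l i | i <- iota 0 v].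

(** The right-hand side of [corr_bound] for c = 2v - 3. *)
Definition ceiling (u w : seq Z) : Z :=
  2 * zsum [seq nth 0 w i | i <- iota 0 v] ^+ 2
    + (2 * v - 3)%:R * sumsq w + sumsq u.

(* A row is a tilt table, its ceiling and a dilation factor. *)
Definition coef (r : seq Z * Z * nat) (j : nat) : Z :=
  nth 0 r.1.1 ((r.2 * j) %% v).

Definition cost (r : seq Z * Z * nat) (j : nat) (e : bool) : N :=
  Z.to_N (if e then coef r j else Z.opp (coef r j)).

(* With signs s, [2 * sum s_j c_j <= C] is equivalent to
   [sum (max 0 (s_j c_j)) <= (C + 2 * sum |c_j|) / 4]: every new sign costs a
   nonnegative amount, so a partial choice that overspends can be dropped. *)
Definition budget (ord : seq nat) (r : seq Z * Z * nat) : N :=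
  Z.to_N (Z.div (r.1.2 + 2 * zsum [seq Z.abs (coef r j) | j <- ord])%R 4).

Definition units : seq nat := [seq m <- iota 0 v | coprime m v].

Definition test_rows (tests : seq (seq Z * seq Z)) : seq (seq Z * Z * nat) :=
  flatten [seq (let t := (tilt p.1 p.2, ceiling p.1 p.2) in
                [seq (t, m) | m <- units]) | p <- tests].

(** Accepts a leaf when dilation by some unit m carries the chosen signs to a listed set. *)
Definition matches (canon : seq (seq nat)) (ord : seq nat) (path : seq bool) :=
  let js := zip ord (rev path) in
  has (fun L => has (fun m => all (fun p => p.2 == ((m * p.1) %% v \in L)%N) js)
                    units) canon.

Definition search_skew canon ord tests (good : nat -> seq bool -> bool)
    (caps : seq nat) : bool :=
  let rows := test_rows tests in
  let cols := [seq ([seq cost r j true | r <- rows],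
                    [seq cost r j false | r <- rows]) | j <- ord] in
  let bs := [seq budget ord r | r <- rows] in
  all (fun c => explore (good c) (matches canon ord) cols bs [::]) caps.

(** One representative of each pair {j, -j}; the signs there determine a skew set. *)
Definition half_system (ord : seq nat) : bool :=
  perm_eq (ord ++ [seq (v - j)%N | j <- ord]) (iota 1 v.-1).

Definition skew_seq (L : seq nat) : bool :=
  (0%N \notin L) && all (fun j => ((v - j)%N \in L) != (j \in L)) (iota 1 v.-1).

Definition setof (L : seq nat) : {set 'Z_v} := [set x : 'Z_v | (x : nat) \in L].

End Tests.

(** Here 4t = 2a + 2b <= C + 2a with t an integer; t >= 0 rules out a negative quotient, which
    [Z.to_N] would truncate. *)
Lemma quarter_floor (C a b t : Z) : 2 * t = a + b -> 0 <= a -> 0 <= t ->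
  2 * b <= C -> t <= Z.of_N (Z.to_N (Z.div (C + 2 * a)%R 4)).
Proof.
move=> tE a0 t0 bC; have := Z.mul_succ_div_gt (C + 2 * a)%R 4 erefl.
by move: (Z.div _ _) => q; lia.
Qed.

Section Search.
Variable v' : nat.
Local Notation v := v'.+2.
Implicit Types (A B : {set 'Z_v}) (x y d : 'Z_v).

Lemma sum_Zp (F : nat -> Z) :
  \sum_(x : 'Z_v) F x = zsum [seq F i | i <- iota 0 v].
Proof.
by rewrite zsumE -(big_mkord xpredT F) /index_iota subn0.
Qed.

Lemma oppZ_nat j : (j <= v)%N -> (v - j)%:R = - j%:R :> 'Z_v.
Proof. by move=> jv; rewrite natrB // pchar_Zp // sub0r. Qed.

Lemma val_natZ n : (n%:R : 'Z_v) = (n %% v)%N :> nat.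
Proof. by rewrite val_Zp_nat. Qed.

Lemma half_system_sum ord (F : 'Z_v -> Z) : half_system v ord ->
  \sum_x F x = F 0 + \sum_(j <- ord) (F j%:R + F (- j%:R)).
Proof.
move=> hs; have -> : \sum_x F x = \sum_(x : 'Z_v) F (x : nat)%:R.
  by apply: eq_bigr => x _; rewrite natr_Zp.
rewrite (sum_Zp (fun i => F i%:R)) zsumE /= big_cons; congr (_ + _).
rewrite -(perm_big _ hs) big_cat big_split /=; congr (_ + _).
rewrite big_map; apply: eq_big_seq => j jo; rewrite oppZ_nat //.
have : j \in iota 1 v'.+1 by rewrite -(perm_mem hs) mem_cat jo.
rewrite mem_iota; lia.
Qed.

Lemma half_system_gt0 ord j : half_system v ord -> j \in ord -> (0 < j < v)%N.
Proof.
move=> hs jo; have : j \in iota 1 v'.+1 by rewrite -(perm_mem hs) mem_cat jo.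
rewrite mem_iota; lia.
Qed.

Lemma natZ_neq0 j : (0 < j < v)%N -> j%:R != 0 :> 'Z_v.
Proof.
move=> jv; apply/eqP => /(congr1 val) /=; rewrite val_natZ modn_small; lia.
Qed.

Lemma mem_setof L (n : nat) : (n%:R \in setof v L) = (n %% v \in L)%N.
Proof. by rewrite inE val_natZ. Qed.

Lemma skew_setof L : skew_seq v L -> skew_set (setof v L).
Proof.
case/andP=> L0 /allP sk; split; first by rewrite inE.
move=> x x0; have xv : (x < v)%N by exact: ltn_ord.
have x_gt0 : (0 < x)%N by rewrite lt0n.
have -> : - x = (v - x)%:R by rewrite oppZ_nat ?natr_Zp // ltnW.
rewrite mem_setof modn_small ?inE; last by rewrite ltn_subrL x_gt0.
have := sk x; rewrite mem_iota x_gt0 add1n xv => /(_ isT).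
by case: (_ \in L); case: (_ \in L).
Qed.

Hypothesis odd_v : odd v.

(** [corr_bound] holds for the pair dilated by m. Reindexing by m makes it a linear inequality in
    the signs of A, and skewness folds the sum onto [ord]. *)
Lemma cost_le k A B ord u w m r : half_system v ord -> skew_pair k A B ->
    coprime m v -> r = ((tilt v u w, ceiling v u w), m) ->
  \sum_(j <- ord) Z.of_N (cost v r j (j%:R \in A)) <= Z.of_N (budget v ord r).
Proof.
move=> hs sp cm rE.
pose W (x : 'Z_v) := nth 0 w x; pose U (x : 'Z_v) := nth 0 u x.
pose X (y : 'Z_v) := \sum_x U x * W (x - y).
have crossE (y : nat) : (y <= v)%N -> cross v u w y = X y%:R.
  move=> yv; rewrite /cross -(sum_Zp (fun i => nth 0 u i * nth 0 w ((i + (v -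
    y)) %% v))).
  apply: eq_bigr => x _; congr (_ * nth 0 w _).
  by rewrite -oppZ_nat // -{2}(natr_Zp x) -natrD val_natZ.
have coefE j : (0 < j < v)%N -> coef v r j = X (m * j)%:R - X (- (m * j)%:R).
  move=> jv; rewrite /coef rE -[_.1.1]/(tilt v u w) -[_.2]/m /tilt.
  have mj : ((m * j) %% v < v)%N by rewrite ltn_mod.
  rewrite (nth_map 0%N) ?size_iota // nth_iota // add0n.
   rewrite !crossE ?leq_subr //; last exact: ltnW.
  by rewrite oppZ_nat ?(ltnW mj) // Zp_nat_mod.
have := skew_pair_dilate cm sp; set A' := dilate m A;
  set B' := dilate m B => sp'.
have := corr_bound U W (fun d => corr_skew_pair odd_v d sp'); rewrite -/(X _).
have -> : \sum_y ssgn A' y * X y = \sum_(j <- ord) ssgn A j%:R * coef v r j.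
  have minj := mulZ_inj cm.
  rewrite (reindex_inj minj) (half_system_sum _ hs) /= mulr0.
  rewrite {1}/ssgn eqxx mul0r add0r; apply: eq_big_seq => j jo.
  have jv := half_system_gt0 hs jo; have j0 := natZ_neq0 jv.
  have sE x : ssgn A' (m%:R * x) = ssgn A x.
    rewrite /ssgn -[0 in LHS](mulr0 (m%:R : 'Z_v)) (inj_eq minj) /psgn.
    by rewrite /A' /dilate mem_imset.
  rewrite !sE coefE // mulrN -natrM mulrBr -mulNr; congr (_ + _ * _).
  rewrite /ssgn oppr_eq0 (negbTE j0) /psgn.
  by have [[_ Ask] _ _] := sp; rewrite Ask //; case: (_ \in A).
have -> : 2 * (\sum_x W x) ^+ 2 + (2 * v - 3)%:R * \sum_x W x ^+ 2
   + \sum_x U x ^+ 2 = ceiling v u w.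
  rewrite /ceiling /sumsq -!sum_Zp.
  by congr (_ + _ * _ + _); apply: eq_bigr => x _; rewrite expr2.
rewrite /budget zsumE [r in r.1.2]rE /= => le_ceil.
(* Each cost is max(0, s c) = (|c| + s c) / 2. *)
have c2 : 2 * \sum_(j <- ord) Z.of_N (cost v r j (j%:R \in A)) =
   \sum_(j <- ord) Z.abs (coef v r j) + \sum_(j <- ord) ssgn A j%:R * coef v r
     j.
  rewrite mulr_sumr -big_split /=; apply: eq_big_seq => j jo.
  have jv := half_system_gt0 hs jo; have j0 := natZ_neq0 jv.
  rewrite /cost /ssgn (negbTE j0) /psgn; case: (_ \in A); lia.
have a0 : 0 <= \sum_(j <- ord) Z.abs (coef v r j).
  by apply: sumr_ge0 => j _; lia.
have c0 : 0 <= \sum_(j <- ord) Z.of_N (cost v r j (j%:R \in A)).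
  by apply: sumr_ge0 => j _; lia.
exact: quarter_floor c2 a0 c0 le_ceil.
Qed.

Lemma search_skew_sound k A B canon ord tests good caps :
    search_skew v canon ord tests good caps -> half_system v ord ->
    all (skew_seq v) canon -> skew_pair k A B ->
    (exists2 c, c \in caps & forall i, (i <= size ord)%N ->
       good c (rev [seq (j%:R \in A) | j <- take i ord])) ->
  exists m L, [/\ (m < v)%N, coprime m v, L \in canon & dilate m A = setof v L].
Proof.
move=> /allP se hs skc sp [c /se {}se gd].
have /hasP[L Lc /hasP[m]] :
    matches v canon ord (catrev [seq (j%:R \in A) | j <- ord] [::]).
  apply: explore_sound se _ gd => r.
  case/flattenP=> rs /mapP[p _ ->] /mapP[m mu ->].
  by apply: cost_le hs sp _ erefl; move: mu; rewrite mem_filter => /andP[].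
rewrite mem_filter mem_iota /= => /andP[cm mv].
have zipE (f : nat -> bool) : zip ord (map f ord) = [seq (j, f j) | j <- ord].
  by elim: (ord) => //= j js ->.
rewrite -/(rev _) revK zipE all_map => /allP ok; exists m, L; split => //.
have [skA _ _] := sp; have [A0 Ask] := skA.
have [L0 Lsk] := skew_setof (allP skc L Lc).
have minj := mulZ_inj cm.
have ordP j : j \in ord -> (j%:R \in A) = (m%:R * j%:R \in setof v L).
  by move=> jo; have /eqP/= -> := ok j jo; rewrite -natrM mem_setof.
(* Both sets are skew, so agreement on the half system extends to all of Z_v. *)
have memE x : (x \in A) = (m%:R * x \in setof v L).
  have [->|x0] := eqVneq x 0; first by rewrite mulr0 (negbTE A0) (negbTE L0).
  have : (x : nat) \in ord ++ [seq (v - j)%N | j <- ord].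
    rewrite (perm_mem hs) mem_iota lt0n; apply/andP; split; first by [].
    exact: ltn_ord.
  rewrite mem_cat => /orP[xo|/mapP[j jo xE]]; first by rewrite -[x]natr_Zp ordP.
  have jv := half_system_gt0 hs jo; have j0 := natZ_neq0 jv.
  rewrite -[x]natr_Zp xE oppZ_nat; last by case/andP: jv => _ /ltnW.
  rewrite Ask // mulrN Lsk -?ordP //.
  by rewrite -[0](mulr0 (m%:R : 'Z_v)) (inj_eq minj).
apply/setP => y;
  have [g mg gm] : bijective ( *%R (m%:R : 'Z_v)) by exact: injF_bij.
by rewrite -[y]gm mem_imset // memE.
Qed.

End Search.

(** * Search for the second set *)

Fixpoint decr (r : seq nat) (i : nat) : option (seq nat) :=
  match r, i with
  | [::], _ => None
  | n :: r', 0 => if n is n'.+1 then Some (n' :: r') else None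
  | n :: r', i'.+1 => if decr r' i' is Some r'' then Some (n :: r'') else None
  end.

Fixpoint decr_all (r ds : seq nat) : option (seq nat) :=
  if ds is d :: ds' then
    if decr r d is Some r' then decr_all r' ds' else None
  else Some r.

(* [k] elements remain to be chosen and [slack] positions may still be skipped;
   the row of a position lists its distances to all positions. *)
Fixpoint place (leaf : seq nat -> bool) (xs : seq (nat * seq nat))
    (ys : seq nat) (k slack : nat) (r : seq nat) : bool :=
  if k is k'.+1 then
    if xs is (x, row) :: xs' then
      (if decr_all r [seq nth 0 row y | y <- ys] is Some r'
       then place leaf xs' (x :: ys) k' slack r' else true) &&
      (if slack is slack'.+1 then place leaf xs' ys k slack' r else true)
    else true
  else leaf ys.

Lemma sub_in_count (T : eqType) (p q : pred T) (s : seq T) :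
  {in s, subpred p q} -> (count p s <= count q s)%N.
Proof.
move=> pq; rewrite (@eq_in_count _ p (predI p q)).
  by apply: sub_count => z /andP[].
by move=> z zs /=; case: (boolP (p z)) => // /(pq _ zs) ->.
Qed.

Section Place.
Local Open Scope nat_scope.
Variable v : nat.

Definition dist (x y : nat) : nat :=
  let d := (x + (v - y)) %% v in minn d (v - d).

Fixpoint npairs (ys : seq nat) (d : nat) : nat :=
  if ys is y :: ys' then count (fun z => dist y z == d) ys' + npairs ys' d else
    0.

(** Distances are tabulated once, so that the search only looks them up. *)
Definition with_rows (xs : seq nat) := [seq (x, mkseq (dist x) v) | x <- xs].

Definition profile (b : pred nat) (d : nat) : nat :=
  count (fun i => b i && b ((i + d) %% v)) (iota 0 v).

Lemma decrP r i : if decr r i is Some r'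
  then forall d, nth 0 r d = nth 0 r' d + (i == d) else nth 0 r i = 0.
Proof.
elim: r i => [|n r IH] [|i] //=; first by case: n => // n [|d] /=;
  rewrite ?addn1 ?addn0.
case: (decr r i) (IH i) => //= r' e [|d] /=; by rewrite ?addn0 ?e.
Qed.

Lemma decr_allP r ds : if decr_all r ds is Some r'
  then forall d, nth 0 r d = nth 0 r' d + count (pred1 d) ds
  else exists2 d, d \in ds & nth 0 r d < count (pred1 d) ds.
Proof.
elim: ds r => [|i ds IH] r /=; first by move=> d; rewrite addn0.
case: (decr r i) (decrP r i) => [r1 e1|e1]; last first.
  by exists i; rewrite ?mem_head //= e1 eqxx.
case: (decr_all r1 ds) (IH r1) => [r2 e2 d|[d di lt_d]].
  by rewrite e1 e2 addnAC addnA.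
by exists d; rewrite ?inE ?di ?orbT //= e1 addnC ltn_add2l.
Qed.

Hypothesis odd_v : odd v.

Lemma distP x y d : x < v -> y < v -> x != y -> dist x y = d ->
  [/\ 0 < d, d.*2 < v & (y == (x + d) %% v) || ((y + d) %% v == x)].
Proof.
move=> xv yv xy; rewrite /dist /= => <-.
have [yx|xy'] := leqP y x.
  have -> : x + (v - y) = (x - y) + v by lia.
  rewrite modnDr (@modn_small (x - y)); last by lia.
  case: (leqP (x - y) (v - (x - y))) => le_d.
    split; [lia| |].
      have : (x - y).*2 != v by apply: contraTneq odd_v => <-;
        rewrite odd_double.
      lia.
    by rewrite subnKC // [x %% v]modn_small // eqxx orbT.
  split; [lia|lia|].
  have -> : x + (v - (x - y)) = y + v by lia.
  by rewrite modnDr (modn_small yv) eqxx.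
rewrite modn_small; last by lia.
case: (leqP (x + (v - y)) (v - (x + (v - y)))) => le_d.
  split; [lia| |].
    have : (x + (v - y)).*2 != v by apply: contraTneq odd_v => <-;
      rewrite odd_double.
    lia.
  have -> : y + (x + (v - y)) = x + v by lia.
  by rewrite modnDr (modn_small xv) eqxx orbT.
split; [lia|lia|].
have -> : x + (v - (x + (v - y))) = y by lia.
by rewrite (modn_small yv) eqxx.
Qed.

(** For 0 < d < v/2, an unordered pair at distance d is {i, i + d} for exactly one of its points i,
    so distinct pairs have distinct starting points. *)
Lemma npairs_le b L d : uniq L -> all (fun i => (i < v) && b i) L ->
  0 < d -> d.*2 < v -> npairs L d <= profile b d.
Proof.
move=> uL aL d0 dv; apply: (@leq_trans (count (fun i => (i + d) %% v \in L) L)).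
  elim: L uL aL => //= x L IH /andP[xL uL] /andP[/andP[xv _] aL].
  have le1 : count (fun z => dist x z == d) L <=
      ((x + d) %% v \in L) + count (fun z => (z + d) %% v == x) L.
    rewrite -(count_uniq_mem _ uL) -count_predUI.
    apply: leq_trans (leq_addr _ _); apply: sub_in_count => z zL /eqP zd.
    have /andP[zv _] := allP aL z zL.
    by have [|_ _] := distP xv zv _ zd; first by apply: contraNneq xL => ->.
  have le2 : count (fun z => (z + d) %% v == x) L
      + count (fun z => (z + d) %% v \in L) L
      <= count (fun z => (z + d) %% v \in x :: L) L.
    rewrite -count_predUI [X in _ + X](@eq_count _ _ pred0) ?count_pred0 ?addn0.
      by apply: sub_count => z /=; rewrite inE.
    move=> z /=; apply/negbTE/negP => /andP[/eqP -> ]; exact/negP.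
  have le3 : ((x + d) %% v \in L) <= ((x + d) %% v \in x :: L).
    by rewrite inE; case: (_ \in L); rewrite ?orbT.
  apply: leq_trans (leq_add le1 (IH uL aL)) _; rewrite -addnA.
  exact: leq_add le3 le2.
rewrite /profile -!size_filter; apply: uniq_leq_size; first exact: filter_uniq.
move=> i; rewrite !mem_filter => /andP[idL iL].
have /andP[iv bi] := allP aL i iL; have /andP[_ bid] := allP aL _ idL.
by rewrite mem_iota iv bi bid.
Qed.

(** The branch that chooses as [b] does survives; along it [r] is the profile of [b] minus the pairs
    already placed. *)
Lemma place_sound leaf b xs ys k slack r :
    place leaf (with_rows xs) ys k slack r -> uniq (xs ++ ys) ->
    all (fun i => i < v) (xs ++ ys) -> all b ys ->
    count b xs = k -> size xs <= k + slack ->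
    (forall d, 0 < d -> d.*2 < v -> profile b d = nth 0 r d + npairs ys d) ->
  exists2 L, leaf L &
    [/\ uniq L, all (fun i => (i < v) && b i) L & size L = size ys + k].
Proof.
elim: xs ys k slack r => [|x xs IH] ys [|k] slack r //=.
- move=> lf uy vy by_ _ _ _; exists ys => //; rewrite addn0; split => //.
  by apply/allP => i iy; rewrite (allP vy) // (allP by_).
- move=> lf /andP[_ uy] /andP[_ vy] by_ _ _ _.
  exists ys => //; rewrite addn0; split => //.
    by move: uy; rewrite cat_uniq => /and3P[].
  apply/allP => i iy; rewrite (allP by_) // andbT.
  by apply: (allP vy); rewrite mem_cat iy orbT.
move=> /andP[take_x skip_x] /andP[xn un] /andP[xv av] by_ cb sz prof.
have vy i : i \in ys -> i < v.
  by move=> iy; apply: (allP av); rewrite mem_cat iy orbT.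
have uy : uniq ys by move: un; rewrite cat_uniq => /and3P[].
case bx: (b x) cb => cb; last first.
  (* Without slack all remaining positions would have to be chosen, against [b x] being false. *)
  case: slack {take_x} skip_x sz => [_ sz|slack skip_x sz].
    by have := count_size b xs; lia.
  by apply: IH skip_x _ _ _ _ _ prof => //; lia.
have rowE : [seq nth 0 (mkseq (dist x) v) y | y <- ys] = [seq dist x y | y <-
  ys].
  by apply/eq_in_map => y /vy yv; rewrite nth_mkseq.
have cntE d : count (pred1 d) [seq dist x y | y <- ys] =
    count (fun z => dist x z == d) ys by rewrite count_map.
have xy y : y \in ys -> x != y.
  by move=> yy; apply: contraNneq xn => ->; rewrite mem_cat yy orbT.
rewrite {}rowE in take_x.
case: (decr_all r _) take_x (decr_allP r [seq dist x y | y <- ys]) => [r'|].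
  move=> take_x rE.
  have [||||||L lf [uL aL sL]] := IH (x :: ys) k slack r' take_x.
  - by rewrite -cat1s uniq_catCA /= xn.
  - by apply/allP => i;
    rewrite mem_cat inE orbCA -mem_cat => /orP[/eqP->//|/(allP av)].
  - by rewrite /= bx.
  - lia.
  - lia.
  - move=> d d0 dv; rewrite prof // rE cntE /=; lia.
  by exists L => //; split; rewrite ?sL //= addSnnS.
(* A distance that runs out would make the chosen points exceed the profile of [b]. *)
move=> _ [d /mapP[y yy dE] lt_d].
have [d0 dv _] := distP xv (vy y yy) (xy y yy) (esym dE).
have : npairs (x :: ys) d <= profile b d.
  apply: npairs_le => //=.
    by rewrite uy andbT; apply: contra xn; rewrite mem_cat orbC => ->.
  by rewrite xv bx; apply/allP => i iy; rewrite vy // (allP by_).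
by rewrite prof //= -cntE; lia.
Qed.

(* A difference [d] that occurs in B can be translated to the pair {0, d}; for
   [d = 0] this only says that B is nonempty. *)
Definition anchor (d : nat) : seq nat := if d == 0 then [:: 0] else [:: d; 0].

Definition partner_count (k : nat) (L : seq nat) (d : nat) : nat :=
  k - count (fun i => (i + d) %% v \in L) L.

(** [r] starts with the counts forced on B, less the pairs of the anchor. Its entry 0 is a filler:
    distinct positions are at distance between 1 and (v - 1) / 2. *)
Definition search_sets leaf (k : nat) (L : seq nat) (d0 : nat) : bool :=
  let ys := anchor d0 in
  let xs := [seq x <- iota 0 v | x \notin ys] in
  let r := mkseq (fun d => partner_count k L d - npairs ys d) v./2.+1 in
  place leaf (with_rows xs) ys (k - size ys) (size xs - (k - size ys)) r.

End Place.

Section SetSearch.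
Variable v' : nat.
Local Notation v := v'.+2.
Implicit Types (A B : {set 'Z_v}).

Lemma card_Zp_pred (p : pred 'Z_v) :
  #|[set x | p x]| = count (fun i => p i%:R) (iota 0 v).
Proof.
rewrite cardE /enum_mem size_filter -enumT.
rewrite -[RHS](count_map (fun i => i%:R : 'Z_v)).
have -> : [seq (i%:R : 'Z_v) | i <- iota 0 v] = enum 'Z_v.
  rewrite -[iota _ _](val_enum_ord v) -map_comp -[RHS]map_id.
  by apply: eq_map => x /=; rewrite natr_Zp.
by apply: eq_count => x /=; rewrite inE.
Qed.

Lemma diff_count_profile B d :
  diff_count B d%:R = profile v (fun i => i%:R \in B) d.
Proof.
rewrite diff_countE.
rewrite card_Zp_pred; apply: eq_count => i /=.
by rewrite -natrD Zp_nat_mod.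
Qed.

Lemma diff_count_setof L d : uniq L -> all (fun i => i < v)%N L ->
  diff_count (setof v L) d%:R = count (fun i => (i + d) %% v \in L)%N L.
Proof.
move=> uL aL; rewrite diff_count_profile /profile -!size_filter.
apply/perm_size/uniq_perm; rewrite ?filter_uniq ?iota_uniq // => i.
rewrite !mem_filter mem_iota /= !mem_setof modn_mod add0n.
case: (boolP (i \in L)) => iL; rewrite ?andbF ?andbT.
  have iv := allP aL i iL.
  by rewrite iv andbT modn_small // iL.
case: (ltnP i v) => iv; rewrite ?andbF //.
by rewrite (modn_small iv) (negbTE iL).
Qed.

Lemma set_eq_setof B L : uniq L -> all (fun i => (i < v)%N && (i%:R \in B)) L ->
  size L = #|B| -> B = setof v L.
Proof.
move=> uL aL sL; apply/esym/eqP; rewrite eqEcard; apply/andP; split.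
  apply/subsetP => x; rewrite inE => /(allP aL)/andP[_].
  by rewrite natr_Zp.
rewrite -sL /setof card_Zp_pred -size_filter; apply: uniq_leq_size => // i iL.
have /andP[iv _] := allP aL i iL.
by rewrite mem_filter mem_iota /= iv andbT val_natZ modn_small.
Qed.

Lemma diff_count_partner k L B n :
    uniq L -> all (fun i => i < v)%N L -> skew_pair k (setof v L) B ->
    (0 < n < v)%N ->
  diff_count B n%:R = partner_count v k L n.
Proof.
move=> uL aL [_ _ AB] nv.
by rewrite /partner_count -(AB _ (natZ_neq0 nv)) diff_count_setof // addKn.
Qed.

Hypothesis odd_v : odd v.

Lemma search_sets_sound leaf k L d0 B :
    search_sets v leaf k L d0 -> uniq L -> all (fun i => i < v)%N L ->
    (d0 < v)%N -> (d0 == 0%N) || (d0.*2 < v)%N ->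
    skew_pair k (setof v L) B -> (0 < diff_count B d0%:R)%N ->
  exists t, exists2 M, leaf M & [set x + t | x in B] = setof v M.
Proof.
move=> se uL aL d0v d0h sp; rewrite diff_countE card_gt0 => /set0Pn[x].
(* Both x and x + d0 lie in B, so translation by -x moves the anchor into B. *)
rewrite inE => /andP[xB xdB]; exists (- x).
have := skew_pair_affine false (- x) sp.
have -> : [set (-1) ^+ false * y + - x | y in B] = [set y - x | y in B].
  by apply: eq_imset => y; rewrite mul1r.
set B' := [set _ | _ in B] => sp'; have [skL Bk AB] := sp'.
have B'0 : 0 \in B' by apply/imsetP; exists x; rewrite ?subrr.
have B'd : d0%:R \in B' by apply/imsetP; exists (x + d0%:R);
  rewrite // addrAC subrr add0r.
pose b i := (i%:R : 'Z_v) \in B'.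
have cb : count b (iota 0 v) = k.
  rewrite -Bk -(card_Zp_pred (mem B')); apply: eq_card => y; by rewrite !inE.
have prof d : (0 < d)%N -> (d.*2 < v)%N -> profile v b d = partner_count v k L
  d.
  move=> dgt0 dv; rewrite -diff_count_profile.
  by apply: (diff_count_partner uL aL sp'); lia.
have ya : all (fun i => (i < v)%N && b i) (anchor d0).
  by rewrite /anchor; case: eqP => _ /=; rewrite /b ?d0v ?B'd ?B'0.
have yu : uniq (anchor d0) by rewrite /anchor; case: eqP => //= d0n;
  rewrite inE andbT; apply/eqP.
have perm_xy : perm_eq ([seq i <- iota 0 v | i \notin anchor d0] ++ anchor d0)
  (iota 0 v).
  apply: uniq_perm; rewrite ?iota_uniq //.
    rewrite cat_uniq filter_uniq ?iota_uniq // yu andbT.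
    by apply/hasPn => i iy; rewrite mem_filter iy.
  move=> i; rewrite mem_cat mem_filter orbC mem_iota /=.
  by case: (boolP (i \in anchor d0)) => // /(allP ya)/andP[-> _].
have cy : count b (anchor d0) = size (anchor d0).
  by apply/eqP; rewrite -all_count; apply: sub_all ya => i /andP[].
have cxs : count b [seq i <- iota 0 v | i \notin anchor d0] = (k - size (anchor
  d0))%N.
  have /permP/(_ b) := perm_xy; rewrite count_cat cb cy => <-.
  by rewrite addnK.
have yk : (size (anchor d0) <= k)%N.
  by have /permP/(_ b) := perm_xy; rewrite count_cat cb cy => <-;
    rewrite leq_addl.
have [||||d dgt0 dv|M lf [uM aM sM]] := place_sound odd_v se _ _ _ cxs _ _.
- by rewrite (perm_uniq perm_xy) iota_uniq.
- by rewrite (perm_all _ perm_xy); apply/allP => i; rewrite mem_iota.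
- by apply: sub_all ya => i /andP[].
- by rewrite -cxs subnKC // count_size.
- have dh : (d < v./2.+1)%N by clear -dv; lia.
  have := npairs_le odd_v yu ya dgt0 dv; rewrite prof // => le_np.
  by rewrite nth_mkseq // subnK.
exists M => //; apply: set_eq_setof => //.
by rewrite sM subnKC // Bk.
Qed.

End SetSearch.

(** * Difference sets modulo a self-conjugate 2 *)

Section SelfConjugate.
Variables (v' a : nat).
Local Notation v := v'.+2.
Hypothesis a_gt0 : (0 < a)%N.
Hypothesis two_a : (2 ^ a)%:R = -1 :> 'Z_v.
Variable B : {set 'Z_v}.
Hypothesis odd_diff : forall d, odd (diff_count B d).

Section CharTwo.
Variables (Q : comNzRingType) (x : Q).
Hypotheses (char2 : 2 \in [pchar Q]) (x_v : x ^+ v = 1).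

Let chi (z : 'Z_v) := x ^+ z.

Let chi_nat n : chi n%:R = x ^+ n.
Proof.
rewrite /chi val_natZ [in RHS](divn_eq n v) exprD mulnC exprM x_v.
by rewrite expr1n mul1r.
Qed.

Let chiD y z : chi (y + z) = chi y * chi z.
Proof. by rewrite -[y]natr_Zp -[z]natr_Zp -natrD !chi_nat exprD. Qed.

Let chiX z n : chi z ^+ n = chi (n%:R * z).
Proof. by rewrite -[z in RHS]natr_Zp -natrM chi_nat mulnC exprM. Qed.

Let pnat2 n : [pchar Q].-nat (2 ^ n)%N.
Proof.
by rewrite pnatX; apply/orP; left; apply/pnatP => // p pr;
  rewrite dvdn_prime2 // => /eqP->.
Qed.

Let frob (T : finType) (P : pred T) (F : T -> Q) n :
  (\sum_(t | P t) F t) ^+ (2 ^ n) = \sum_(t | P t) F t ^+ (2 ^ n).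
Proof.
apply: (big_morph (fun y : Q => y ^+ (2 ^ n)) (op1 := +%R)).
  by move=> y z; rewrite exprDn_pchar.
by rewrite expr0n expn_eq0.
Qed.

(* [S * S^(2^a)] is the sum of [diff_count B d] times [chi d], hence of all
   [chi d], so [N = (x - 1) S] satisfies [N ^ (2^a + 1) = 0]; but
   [N ^ (2^(2a)) = N] since [2^(2a)] is [1] modulo [v]. *)
Lemma self_conjugate_shift : \sum_(b in B) chi b = \sum_(b in B) chi (b + 1).
Proof.
pose S := \sum_(b in B) chi b; pose N := (chi 1 - 1) * S.
have Sa : S ^+ (2 ^ a) = \sum_(b in B) chi (- b).
  by rewrite frob; apply: eq_bigr => b _; rewrite chiX two_a mulN1r.
have SS : S * S ^+ (2 ^ a) = \sum_d chi d.
  rewrite Sa mulrC mulr_suml.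
  transitivity (\sum_(c in B) \sum_d ((c + d \in B)%:R : Q) * chi d).
    apply: eq_bigr => c _; rewrite mulr_sumr big_mkcond /=.
    rewrite (reindex_inj (addrI c)) /=; apply: eq_bigr => d _.
    by rewrite -chiD addKr; case: (_ \in B); rewrite ?mul1r ?mul0r.
  rewrite exchange_big; apply: eq_bigr => d _ /=; rewrite -mulr_suml -natr_sum.
  have -> : (\sum_(c in B) ((c + d)%R \in B) = diff_count B d)%N.
    rewrite diff_countE -sum1_card big_mkcond [RHS]big_mkcond.
    by apply: eq_bigr => c _; rewrite inE; do 2 case: (_ \in B).
  by rewrite -[diff_count B d]odd_double_half odd_diff -muln2 natrD natrM
       (pcharf0 char2) mulr0 addr0 mul1r.
have two_2a : (2 ^ (a + a))%:R = 1 :> 'Z_v.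
  by rewrite expnD natrM two_a mulrNN mulr1.
have NS : N * S ^+ (2 ^ a) = 0.
  rewrite /N -mulrA SS mulrBl mul1r mulr_sumr; apply/eqP; rewrite subr_eq0.
  by apply/eqP; rewrite [RHS](reindex_inj (addrI 1)); apply: eq_bigr => d _;
    rewrite chiD.
have two_a_gt1 : (1 < 2 ^ a)%N.
  by rewrite -[1%N]/(2 ^ 0)%N ltn_exp2l.
have N0 : N ^+ (2 ^ (a + a)) = 0.
  have [k kE] : exists k, (2 ^ (a + a) = (2 ^ a).+1 + k)%N.
    exists (2 ^ (a + a) - (2 ^ a).+1)%N; rewrite subnKC // expnD.
    by have := two_a_gt1; nia.
  by rewrite kE exprD exprS {2}/N exprMn mulrCA NS !(mulr0, mul0r).
have NE : N ^+ (2 ^ (a + a)) = N.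
  rewrite /N exprMn frob; congr (_ * _).
    by rewrite exprDn_pchar // exprNn_pchar // expr1n chiX two_2a mul1r.
  by apply: eq_bigr => b _; rewrite chiX two_2a mul1r.
move: N0; rewrite NE /N mulrBl mul1r => /subr0_eq; rewrite -/S => <-.
by rewrite mulr_sumr; apply: eq_bigr => b _; rewrite -chiD addrC.
Qed.

End CharTwo.

(** In F_2[X] / (X^v - 1) the powers of X below v are independent, so [self_conjugate_shift] forces
    B = B + 1, and a nonempty such B is everything. *)
Lemma self_conjugate_full b : b \in B -> B = setT.
Proof.
pose M : {poly 'F_2} := 'X^v - 1.
have sM : size M = v.+1 by rewrite size_XnsubC.
have mM : M \is monic by rewrite monicXnsubC.
have mkM : mk_monic M = M by rewrite /mk_monic sM mM.
have c2 : 2 \in [pchar {poly %/ M}] by rewrite pchar_qpoly pchar_Fp.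
pose x : {poly %/ M} := in_qpoly M 'X.
have xX n : x ^+ n = in_qpoly M 'X^n by rewrite /x -rmorphXn.
have xv : x ^+ v = 1.
  apply/eqP; rewrite -subr_eq0 xX -(in_qpoly1 M) -rmorphB; apply/eqP/val_inj.
  by rewrite /= mkM Pdiv.RingMonic.rmodpp.
have shift := self_conjugate_shift c2 xv.
have sumE (f : 'Z_v -> 'Z_v) : \sum_(b in B) x ^+ f b = in_qpoly M (\sum_(b in
  B) 'X^(f b)).
  by rewrite rmorph_sum; apply: eq_bigr => y _; rewrite xX.
have sz (f : 'Z_v -> 'Z_v) : (size (\sum_(b in B) 'X^(f b) : {poly 'F_2})%R <
  size (mk_monic M))%N.
  rewrite mkM sM ltnS; apply: leq_trans (size_sum _ _ _) _.
  by apply/bigmax_leqP => y _; rewrite size_polyXn; exact: ltn_ord.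
have polyE : \sum_(b in B) 'X^b = \sum_(b in B) 'X^((b + 1)%R : 'Z_v) :> {poly
  'F_2}.
  rewrite -(in_qpoly_small (sz id)) -(in_qpoly_small (sz (fun y => y + 1))).
  by rewrite -(sumE id) shift sumE.
have memB y : (y \in B) = (y - 1 \in B).
  have := congr1 (fun p : {poly 'F_2} => p`_y) polyE; rewrite !coef_sum.
  have pick (f : 'Z_v -> 'Z_v) z : (forall b, (f b == y) = (b == z)) ->
      \sum_(b in B) ('X^(f b) : {poly 'F_2})`_y = (z \in B)%:R.
    move=> fz; under eq_bigr do rewrite coefXn eq_sym (inj_eq val_inj) fz.
    rewrite big_mkcond (bigD1 z) //= eqxx big1 ?addr0; first by case: (_ \in B).
    by move=> b' /negbTE ->; case: (_ \in B).
  rewrite (pick id y) // (pick (fun b => b + 1) (y - 1)); last first.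
    by move=> z; exact: (can2_eq (addrK 1) (subrK 1)).
  by do 2 case: (_ \in B).
move=> bB; apply/setP => z; rewrite inE -(subrK b z) -[z - b]natr_Zp.
elim: (nat_of_ord _) => [|n IH]; first by rewrite add0r.
by rewrite memB -natr1 addrAC addrK.
Qed.

End SelfConjugate.

(** * Norms at an inert prime *)

Definition dvZ (m x : Z) : Prop := exists q : Z, x = m * q.
Arguments dvZ (m x)%_R.

Lemma dvZ_sum (m : Z) (T : finType) (P : pred T) (F : T -> Z) :
  (forall t, P t -> dvZ m (F t)) -> dvZ m (\sum_(t | P t) F t).
Proof.
move=> dvF; apply: (big_ind (dvZ m)) => //; first by exists 0; rewrite mulr0.
by move=> x y [q ->] [r ->]; exists (q + r); rewrite mulrDr.
Qed.

Fixpoint all_from (f : Z -> bool) (n : nat) (x : Z) : bool :=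
  if n is n'.+1 then f x && all_from f n' (x + 1) else true.

Lemma all_fromP f n x y : all_from f n x -> x <= y -> y < x + Z.of_nat n -> f y.
Proof.
elim: n x => [|n IH] x /=; first by lia.
case/andP=> fx al xy yn; have [<-//|/eqP xny] := eqVneq x y.
by apply: IH al _ _; lia.
Qed.

Definition prime_below (n : nat) (p : Z) : bool :=
  all_from (fun d => Z.modulo p d != 0) n 2.

(** The range 0 <= x < mn is cut into m blocks of length n to keep the unary counters small. *)
Definition nonsquare_mod (m n : nat) (p D : Z) : bool :=
  all (fun i => all_from (fun x => Z.modulo (x * x - D)%R p != 0) n
                  (Z.of_nat i * Z.of_nat n)) (iota 0 m).

(** Trial division by 2, ..., n + 1 suffices, as a composite p has a divisor at most its square
    root. *)
Lemma prime_belowP n (p : Z) :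
  1 < p -> p < (Z.of_nat n + 2) * (Z.of_nat n + 2) -> prime_below n p ->
    Znumtheory.prime p.
Proof.
move=> p1 pn al; apply/Znumtheory.prime_alt; split; first by lia.
have nodiv d q : 1 < d -> d < Z.of_nat n + 2 -> p = q * d -> False.
  move=> d1 dn pE; have := all_fromP al (y := d); rewrite pE.
  have -> : Z.modulo (q * d)%R d = 0 by exact: Z_mod_mult.
  by rewrite eqxx => /(_ _ _)/implyP; lia.
move=> d d1n [q pE]; case: (ltP d (Z.of_nat n + 2)) => dn;
  first by apply: (nodiv d q); lia.
apply: (nodiv q d); try lia; nia.
Qed.

(** Since x and -x have the same square, testing the residues up to p/2 is enough. *)
Lemma nonsquare_modP m n (p D x q : Z) : 0 < p ->
  p < 2 * (Z.of_nat m * Z.of_nat n) ->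
  nonsquare_mod m n p D -> x * x - D = p * q -> False.
Proof.
move=> p0 pn al xE; pose b := Z.of_nat m * Z.of_nat n.
have key y r : 0 <= y -> y < b -> y * y - D = p * r -> False.
  move=> y0 yn yE; have n0 : Z.lt 0 (Z.of_nat n) by rewrite /b in yn; nia.
  have yd := Z.div_mod y (Z.of_nat n) ltac:(lia).
  have [ym0 ym1] := Z.mod_pos_bound y (Z.of_nat n) n0.
  have yd0 : Z.le 0 (Z.div y (Z.of_nat n)) by apply: Z.div_pos; lia.
  have ydm : Z.lt (Z.div y (Z.of_nat n)) (Z.of_nat m).
    by apply: Z.div_lt_upper_bound => //; rewrite /b in yn; lia.
  have /allP/(_ (Z.to_nat (Z.div y (Z.of_nat n)))) := al.
  rewrite mem_iota;
    have -> /= : (Z.to_nat (Z.div y (Z.of_nat n)) < 0 + m)%N by lia.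
  move=> /(_ isT) {}al; have := all_fromP al (y := y); rewrite /= yE.
  have -> : Z.modulo (p * r)%R p = 0 by rewrite [(p * r)%R]mulrC;
    exact: Z_mod_mult.
  rewrite eqxx Z2Nat.id // => /(_ _ _)/implyP; lia.
have p_neq0 : p <> 0 by lia.
have pZ : Z.lt 0 p by lia.
have [m0 m1] := Z.mod_pos_bound x p pZ.
have := Z.div_mod x p p_neq0; rewrite -[RHS]/(p * _ + _).
move: (Z.modulo x p) (Z.div x p) m0 m1 => e d e0 e1 dE.
have redE : e * e - D = (x * x - D) - p * (d * (x + e)) by rewrite dE; ring.
case: (ltP e b) => eb.
  by apply: (key e (q - d * (x + e))); [lia|lia|rewrite redE xE; ring].
apply: (key (p - e) (q - d * (x + e) + p - 2 * e)); [lia|rewrite -/b in pn;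
  lia|].
have -> : (p - e) * (p - e) - D = (e * e - D) + p * (p - 2 * e) by ring.
by rewrite redE xE; ring.
Qed.

(* [p] is inert in the quadratic extension generated by a root of [D], so it
   divides a norm from that extension to an even power. *)
Lemma norm_form_sqr (p D a b : Z) : Znumtheory.prime p ->
    (forall x q, x * x - D = p * q -> False) ->
  dvZ p (a * a - D * (b * b)) -> dvZ (p * p) (a * a - D * (b * b)).
Proof.
move=> pr nsq [q qE].
have [[c bE]|npb] := Znumtheory.Zdivide_dec p b.
  have {}bE : b = c * p by exact: bE.
  have : Z.divide p (a * a)%R.
    exists (q + D * c * b); rewrite -[RHS]/((q + D * c * b) * p).
    by rewrite -[LHS](subrK (D * (b * b))) qE {1}bE; ring.
  by case/(Znumtheory.prime_mult _ pr) => -[e aE]; have {}aE : a = e * p by [];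
    exists (e * e - D * (c * c)); rewrite aE bE; ring.
(* If p does not divide b, then b is invertible modulo p and a/b is a square root of D. *)
have /Znumtheory.rel_prime_bezout[u w e] := Znumtheory.prime_rel_prime _ pr _
  npb.
exfalso; apply: (nsq (a * w) (w * w * q + D * u * (u * p - 2))).
have {}e : u * p + w * b = 1 by exact: e.
have -> : a * w * (a * w) - D
   = w * w * (a * a - D * (b * b)) + D * (w * b * (w * b) - 1) by ring.
have -> : w * b = 1 - u * p by rewrite -e; ring.
by rewrite qE; ring.
Qed.

(** The norm form is divisible by p, hence by p^2, and so p^2 divides 2pe. *)
Lemma norm_form_dvd (p D a b e : Z) : Znumtheory.prime p ->
    (forall x q, x * x - D = p * q -> False) ->
  dvZ (p * p) (a * a - D * (b * b) - 2 * (p * e)) -> dvZ p (2 * e).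
Proof.
move=> pr nsq [q qE].
have [|r rE] := @norm_form_sqr p D a b pr nsq.
  by exists (p * q + 2 * e); rewrite -[LHS](subrK (2 * (p * e))) qE; ring.
exists (r - q); have p0 : p != 0 by have := Znumtheory.prime_ge_2 _ pr; lia.
apply: (mulfI p0); rewrite rE in qE.
transitivity (p * p * r - (p * p * r - 2 * (p * e))); first by ring.
by rewrite qE; ring.
Qed.

Section Lucas.
Variable v' : nat.
Local Notation v := v'.+2.
Variables (m D : Z) (c s : seq Z).
Implicit Types (B : {set 'Z_v}).

(** With c_n = z^n + z^-n, s_n = (z^n - z^-n) / (z - 1/z) and D = (z - 1/z)^2, this is c_x c_y - D
    s_x s_y = 2 c_(y-x). *)
Definition addition_law : bool :=
  all (fun x => all (fun y => Z.modulo (nth 0 c x * nth 0 c y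
      - D * (nth 0 s x * nth 0 s y) - 2 * nth 0 c ((y + (v - x)) %% v))%R m ==
        0)
    (iota 0 v)) (iota 0 v).

(** The addition law is summed over B x B. Formally a = B(z) + B(1/z) and b (z - 1/z) = B(z) -
    B(1/z), so the norm form is 4 B(z) B(1/z). *)
Lemma norm_form_profile B : 0 < m -> addition_law ->
  exists a b, dvZ m (a * a - D * (b * b)
    - 2 * \sum_(d : 'Z_v) (diff_count B d)%:R * nth 0 c d).
Proof.
move=> m0 /allP al.
pose C (x : 'Z_v) := nth 0 c x; pose S (x : 'Z_v) := nth 0 s x.
have law (x y : 'Z_v) : dvZ m (C x * C y - D * (S x * S y) - 2 * C (y - x)).
  have := al x; rewrite mem_iota ltn_ord => /(_ isT)/allP/(_ y).
  rewrite mem_iota ltn_ord => /(_ isT)/eqP.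
  have -> : nth 0 c ((y + (v - x)) %% v) = C (y - x).
    congr (nth 0 c _); rewrite -val_natZ natrD oppZ_nat ?natr_Zp //.
    exact: ltnW (ltn_ord x).
  move=> e; exists (Z.div (C x * C y - D * (S x * S y) - 2 * C (y - x))%R m).
  by rewrite [LHS](Z.div_mod _ m) ?[Z.modulo _ _]e ?addr0 //; lia.
exists (\sum_(x in B) C x), (\sum_(x in B) S x).
have -> : \sum_(d : 'Z_v) (diff_count B d)%:R * nth 0 c d
    = \sum_(x in B) \sum_(y in B) C (y - x).
  transitivity (\sum_(x in B) \sum_d ((x + d \in B)%:R : Z) * C d).
    rewrite exchange_big; apply: eq_bigr => d _ /=;
      rewrite -mulr_suml -natr_sum.
    congr (_%:R * _); rewrite diff_countE -sum1_card big_mkcond [RHS]big_mkcond.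
    by apply: eq_bigr => x _; rewrite inE; do 2 case: (_ \in B).
  apply: eq_bigr => x _;
    rewrite [RHS]big_mkcond [RHS](reindex_inj (addrI x)) /=.
  by apply: eq_bigr => d _; rewrite addrAC subrr add0r; case: (_ \in B);
    rewrite ?mul1r ?mul0r.
have -> : (\sum_(x in B) C x) * (\sum_(x in B) C x)
    - D * ((\sum_(x in B) S x) * (\sum_(x in B) S x))
    - 2 * \sum_(x in B) \sum_(y in B) C (y - x)
  = \sum_(x in B) \sum_(y in B) (C x * C y - D * (S x * S y) - 2 * C (y - x)).
  rewrite !mulr_suml mulr_sumr mulr_sumr -!sumrB; apply: eq_bigr => x _.
  by rewrite !mulr_sumr -!sumrB.
by apply: dvZ_sum => x _; apply: dvZ_sum => y _.
Qed.

End Lucas.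

(** * Reduction by dilations and translations *)

(* [path] lists the signs most recent first.  Its earliest signs are [r] times
   true and then false, and no run is longer than [r]. *)
Definition capped_runs (r : nat) (path : seq bool) : bool :=
  if (size path <= r)%N then head true path
  else if size path == r.+1 then ~~ head false path
  else ~~ constant (take r.+1 path).

(** 3 is a primitive root modulo 43 and 3^21 = -1, so these form a half system along which dilation
    by 3 is a shift. *)
Definition powers3 : seq nat := traject (fun x => 3 * x %% 43)%N 1 21.

(** The signs n -> [3^n in A] change under n -> n + 21, hence have period 42 and runs of length at
    most 21. A dilation by a power of 3 brings the start of a longest run of true signs to exponent
    0. *)
Lemma capped_runs_exists k (A B : {set 'Z_43}) : skew_pair k A B ->
  exists2 m, coprime m 43 & exists2 c, c \in iota 1 21 &
    forall i, (i <= size powers3)%N ->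
      capped_runs c (rev [seq (j%:R \in dilate m A) | j <- take i powers3]).
Proof.
move=> [[_ Ask] _ _].
have [g gE] : exists g : 'Z_43, g = 3%:R by exists 3%:R.
pose sg n := g ^+ n \in A.
have g21 : g ^+ 21 = -1 by apply/eqP; rewrite gE; vm_compute.
have unit_g : g \is a GRing.unit by rewrite gE unitZpE.
have g_neq0 n : g ^+ n != 0.
  by apply: contraTneq (unitrX n unit_g) => ->; rewrite unitr0.
have sgN n : sg (n + 21)%N = ~~ sg n.
  by rewrite /sg exprD g21 mulrN1 Ask.
have sg42 n : sg (n + 42)%N = sg n by rewrite -[42%N]/(21 + 21)%N addnA !sgN
  negbK.
have sgM n : sg (n %% 42)%N = sg n.
  rewrite {2}(divn_eq n 42) addnC; elim: (n %/ 42)%N => [|q IH];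
    first by rewrite addn0.
  by rewrite mulSn addnCA addnC sg42 addnC IH addnC.
pose run n r := all (fun j => sg (n + j)%N) (iota 0 r).
pose P r := has (fun n => run n r) (iota 0 42).
have runM n r : run (n %% 42)%N r = run n r.
  by apply: eq_all => j; rewrite -sgM modnDml sgM.
have runP n r : run n r -> P r.
  by move=> nr; apply/hasP; exists (n %% 42)%N;
    rewrite ?mem_iota ?ltn_mod ?runM.
have exP : exists r, P r.
  by exists 0%N; apply: (runP 0%N).
have boundP r : P r -> (r <= 21)%N.
  case/hasP=> n _ /allP al; rewrite leqNgt; apply/negP => r21.
  have := al 21%N; have := al 0%N;
    rewrite !mem_iota !add0n r21 (ltn_trans _ r21) //.
  by rewrite sgN addn0 => /(_ isT) -> /(_ isT).
case: (ex_maxnP exP boundP) => r /hasP[n0 _ rn0] rmax.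
have r1 : (0 < r)%N.
  apply: rmax; have [s0|s0] := boolP (sg 0); first by apply: (runP 0%N);
    rewrite /run /= s0.
  by apply: (runP 21%N); rewrite /run /= addn0 -[21%N]add0n sgN s0.
have no_run n : ~~ run n r.+1.
  by apply/negP => /runP /rmax; rewrite ltnn.
(* This is 3^(-n0), which shifts the run starting at n0 to 0. *)
pose m := (3 ^ (42 - n0 %% 42) %% 43)%N.
exists m; first by rewrite coprime_modl coprimeXl.
exists r; first by rewrite mem_iota r1 add1n ltnS boundP //; apply: runP rn0.
have memE n : (g ^+ n \in dilate m A) = sg (n0 + n)%N.
  have mE : m%:R = g ^+ (42 - n0 %% 42) by rewrite gE /m Zp_nat_mod // natrX.
  have e42 : g ^+ 42 = 1.
    by rewrite -[42%N]/(21 + 21)%N exprD g21 mulrNN mulr1.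
  have cm : coprime m 43 by rewrite coprime_modl coprimeXl.
  have -> : g ^+ n = m%:R * g ^+ (n0 %% 42 + n).
    rewrite mE -exprD addnA subnK ?exprD ?e42 ?mul1r //.
    exact/ltnW/ltn_mod.
  rewrite mem_imset; last exact: mulZ_inj.
  by rewrite -/(sg _) -sgM modnDml sgM.
have trajE i : (i <= 21)%N -> [seq (j%:R \in dilate m A) | j <- take i powers3]
    = [seq sg (n0 + n)%N | n <- iota 0 i].
  move=> i21; rewrite /powers3 take_traject //.
  apply: (@eq_from_nth _ false);
    rewrite ?size_map ?size_traject ?size_iota // => n ni.
  rewrite (nth_map 1%N) ?size_traject // (nth_map 0%N) ?size_iota //.
  rewrite nth_iota // nth_traject // add0n -memE.
  suff -> : (iter n (fun x => 3 * x %% 43)%N 1%N)%:R = g ^+ n by [].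
  elim: n {ni} => [|n IH] //=.
  by rewrite Zp_nat_mod // natrM IH exprS gE.
rewrite size_traject => i i21;
  rewrite trajE // /capped_runs size_rev size_map size_iota.
case: (leqP i r) => ir.
  case: i i21 ir => [|i] i21 ir //.
  rewrite -addn1 iotaD map_cat rev_cat /= add0n.
  by have /allP := rn0; apply; rewrite mem_iota.
case: eqP => [->|ir1].
  rewrite -addn1 iotaD map_cat rev_cat /= add0n.
  apply: contra (no_run n0) => sr.
  by rewrite /run -addn1 iotaD all_cat -/(run n0 r) rn0 /= sr.
have rr1i : (r.+1 <= i)%N by [].
rewrite take_rev size_map size_iota -map_drop drop_iota add0n subKn //.
apply/negP => cst; pose n := (n0 + (i - r.+1))%N.
have [b all_b] : exists b, forall j, (j < r.+1)%N -> sg (n + j)%N = b.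
  move: cst; set w := rev _ => cst; exists (head true w) => j jr.
  have : sg (n + j)%N \in w.
    rewrite mem_rev /n -addnA; apply: (map_f (fun n => sg (n0 + n)%N));
      rewrite mem_iota leq_addr /=; lia.
  by case: w cst => //= x w /allP al; rewrite inE => /orP[/eqP//|/al/eqP].
case: b all_b => all_b.
  by case/negP: (no_run n); apply/allP => j; rewrite mem_iota => jr;
    rewrite all_b.
(* A run of false signs becomes a run of true signs 21 places further. *)
case/negP: (no_run (n + 21)%N); apply/allP => j; rewrite mem_iota => jr.
by rewrite addnAC sgN all_b.
Qed.

Section Equivalence.
Variable v' : nat.
Local Notation v := v'.+2.
Implicit Types (A B : {set 'Z_v}).

Lemma sds_equiv_dilate m A B : (m < v)%N -> coprime m v ->
  sds_equiv (A, B) (dilate m A, dilate m B).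
Proof.
move=> mv cm; apply/rst_step/SdsMult => //; rewrite mv andbT lt0n.
by apply: contraTneq cm => ->; rewrite /coprime gcd0n.
Qed.

Lemma sds_equiv_affineR (s : bool) t A B :
  sds_equiv (A, B) (A, [set (-1) ^+ s * y + t | y in B]).
Proof.
apply: rst_step; have := SdsAffine false s 0 t A B.
have -> : [set (-1) ^+ false * x + 0 | x in A] = A.
  by under eq_imset do rewrite mul1r addr0; rewrite imset_id.
by [].
Qed.

(** Only the inclusion of an image of L in L' is tested; [moves_toP] gets equality from the
    cardinalities. *)
Definition moves_to (L' L : seq nat) : bool :=
  has (fun t => all (fun i => (i + t) %% v \in L')%N L
             || all (fun i => (v - i + t) %% v \in L')%N L) (iota 0 v).

Lemma moves_toP k L L' : moves_to L' L -> uniq L' -> size L' = k ->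
  all (fun i => i < v)%N L' -> #|setof v L| = k ->
  exists (s : bool) t, setof v L' = [set (-1) ^+ s * y + t | y in setof v L].
Proof.
move=> /hasP[t _ mv] uL' sL' aL' cL.
suff [s sE] : exists s : bool, forall x, x \in setof v L ->
    (-1) ^+ s * x + t%:R \in setof v L'.
  exists s, t%:R; apply/esym/eqP; rewrite eqEcard; apply/andP; split.
    by apply/subsetP => y /imsetP[x xL ->]; exact: sE.
  rewrite card_imset; last by move=> x y /addIr/(mulrI (unitrX _ (unitrN1 _))).
  rewrite cL -sL' /setof card_Zp_pred -size_filter; apply: uniq_leq_size.
    by rewrite filter_uniq ?iota_uniq.
  by move=> i; rewrite mem_filter mem_iota => /andP[+ iv];
    rewrite val_natZ modn_small.
have xv (x : 'Z_v) : (x <= v)%N by exact: ltnW (ltn_ord x).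
case/orP: mv => /allP al; [exists false|exists true] => x; rewrite !inE => xL.
  have -> : (-1) ^+ false * x + t%:R = (x + t)%:R.
    by rewrite expr0 mul1r natrD natr_Zp.
  by rewrite val_natZ; exact: al.
have -> : (-1) ^+ true * x + t%:R = (v - x + t)%:R.
  by rewrite expr1 mulN1r natrD oppZ_nat ?natr_Zp.
by rewrite val_natZ; exact: al.
Qed.

Hypothesis odd_v : odd v.

Lemma sds_equiv_search k L L' d0 B :
    search_sets v (moves_to L') k L d0 -> uniq L -> all (fun i => i < v)%N L ->
    (d0 < v)%N -> (d0 == 0%N) || (d0.*2 < v)%N ->
    uniq L' -> size L' = k -> all (fun i => i < v)%N L' ->
    skew_pair k (setof v L) B -> (0 < diff_count B d0%:R)%N ->
  sds_equiv (setof v L, B) (setof v L, setof v L') /\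
    skew_pair k (setof v L) (setof v L').
Proof.
move=> se uL aL d0v d0h uL' sL' aL' sp Bd.
have [t [M mM BM]] := search_sets_sound odd_v se uL aL d0v d0h sp Bd.
have eq1 := sds_equiv_affineR false t (setof v L) B.
have := skew_pair_affine false t sp.
have BE : [set (-1) ^+ false * y + t | y in B] = setof v M.
  by rewrite -BM; apply: eq_imset => y; rewrite mul1r.
rewrite BE in eq1 *; move=> spM; have [_ Mk _] := spM.
have [s [r ->]] := moves_toP mM uL' sL' aL' Mk.
split; last exact: skew_pair_affine.
exact: rst_trans eq1 (sds_equiv_affineR _ _ _ _).
Qed.

(** Complementing B adds v - 2k to each of its counts, turning lambda = k into v - k. *)
Lemma skew_pair_compl k A B : skew_pair k A B -> skew_pair (v - k) A (~: B).
Proof.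
move=> [skA Bk AB];
  have cB : (k + #|~: B| = v)%N by rewrite -Bk cardsC card_ord.
split=> // [|d d0]; first by rewrite -[RHS](congr1 (subn^~ k) cB) addKn.
have := diff_countC B d; have := AB d d0; rewrite Bk; lia.
Qed.

End Equivalence.

(** * The six orders *)

Section Tables.
Local Open Scope Z_scope.

(* Pairs (u, w) for [corr_bound]: w and u are 10 cos(2 pi f x / v) and
   10 sqrt(2v - 3) sin(2 pi f x / v), rounded, for f = 1 and, when v = 21, also
   for f = 3 and f = 7, which the dilations do not reach from f = 1. *)
Definition tests3 : seq (seq Z * seq Z) :=
  [:: ([:: 0; 15; -15],
    [:: 10; -5; -5])].

Definition tests7 : seq (seq Z * seq Z) :=
  [:: ([:: 0; 26; 32; 14; -14; -32; -26],
    [:: 10; 6; -2; -9; -9; -2; 6])].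

Definition tests13 : seq (seq Z * seq Z) :=
  [:: ([:: 0; 22; 39; 48; 45; 32; 11; -11; -32; -45; -48; -39; -22],
    [:: 10; 9; 6; 1; -4; -7; -10; -10; -7; -4; 1; 6; 9])].

Definition tests21 : seq (seq Z * seq Z) :=
  [:: ([:: 0; 18; 35; 49; 58; 62; 61; 54; 42; 27; 9; -9; -27; -42; -54; -61;
    -62;
      -58; -49; -35; -18],
    [:: 10; 10; 8; 6; 4; 1; -2; -5; -7; -9; -10; -10; -9; -7; -5; -2; 1; 4; 6;
      8; 10]);
   ([:: 0; 49; 61; 27; -27; -61; -49; 0; 49; 61; 27; -27; -61; -49; 0; 49; 61;
      27; -27; -61; -49],
    [:: 10; 6; -2; -9; -9; -2; 6; 10; 6; -2; -9; -9; -2; 6; 10; 6; -2; -9; -9;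
      -2; 6]);
   ([:: 0; 54; -54; 0; 54; -54; 0; 54; -54; 0; 54; -54; 0; 54; -54; 0; 54;
      -54; 0; 54; -54],
    [:: 10; -5; -5; 10; -5; -5; 10; -5; -5; 10; -5; -5; 10; -5; -5; 10; -5;
      -5; 10; -5; -5])].

Definition tests31 : seq (seq Z * seq Z) :=
  [:: ([:: 0; 15; 30; 44; 56; 65; 72; 76; 77; 74; 69; 61; 50; 37; 23; 8; -8;
    -23;
      -37; -50; -61; -69; -74; -77; -76; -72; -65; -56; -44; -30; -15],
    [:: 10; 10; 9; 8; 7; 5; 3; 2; -1; -3; -4; -6; -8; -9; -10; -10; -10; -10;
      -9; -8; -6; -4; -3; -1; 2; 3; 5; 7; 8; 9; 10])].

Definition tests43 : seq (seq Z * seq Z) :=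
  [:: ([:: 0; 13; 26; 39; 50; 61; 70; 78; 84; 88; 91; 91; 90; 86; 81; 74; 66;
    56;
      45; 33; 20; 7; -7; -20; -33; -45; -56; -66; -74; -81; -86; -90; -91;
      -91; -88; -84; -78; -70; -61; -50; -39; -26; -13],
    [:: 10; 10; 10; 9; 8; 7; 6; 5; 4; 3; 1; 0; -2; -3; -5; -6; -7; -8; -9; -9;
      -10; -10; -10; -10; -9; -9; -8; -7; -6; -5; -3; -2; 0; 1; 3; 4; 5; 6;
      7; 8; 9; 10; 10])].

End Tables.

Definition A3 : seq nat :=
  [:: 2]%N.
Definition A7 : seq nat :=
  [:: 3; 5; 6]%N.
Definition A13 : seq nat :=
  [:: 4; 7; 8; 10; 11; 12]%N.
Definition A21 : seq nat :=
  [:: 2; 3; 9; 11; 13; 14; 15; 16; 17; 20]%N.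
Definition A31 : seq nat :=
  [:: 4; 6; 7; 12; 16; 17; 18; 20; 21; 22; 23; 26; 28; 29; 30]%N.
Definition A43 : seq nat :=
  [:: 3; 4; 5; 6; 9; 12; 13; 14; 15; 16; 17; 18; 20; 22; 24; 32; 33; 35; 36;
      41; 42]%N.
Definition B7 : seq nat := [:: 0]%N.
Definition B13 : seq nat := [:: 0; 2; 8]%N.
Definition B21 : seq nat := [:: 0; 1; 7; 9; 12; 17]%N.
Definition B31 : seq nat := [:: 0; 1; 4; 5; 8; 11; 16; 18; 20; 29]%N.

(** For the primes 31 and 43, both 3 modulo 4, -1 is not a square, so this is a skew set: the Paley
    difference set. *)
Definition squares (v : nat) : seq nat :=
  undup [seq (x * x %% v)%N | x <- iota 1 v.-1].

(** * Running the searches *)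

Lemma skew_search3 :
  search_skew 3 [:: A3] (iota 1 1) tests3 (fun _ _ => true) [:: 0%N].
Proof. by vm_compute. Qed.

Lemma skew_search7 :
  search_skew 7 [:: A7] (iota 1 3) tests7 (fun _ _ => true) [:: 0%N].
Proof. by vm_compute. Qed.

Lemma skew_search13 :
  search_skew 13 [:: A13] (iota 1 6) tests13 (fun _ _ => true) [:: 0%N].
Proof. by vm_compute. Qed.

Lemma skew_search21 :
  search_skew 21 [:: A21] (iota 1 10) tests21 (fun _ _ => true) [:: 0%N].
Proof. by vm_compute. Qed.

Lemma skew_search31 :
  search_skew 31 [:: A31; squares 31] (iota 1 15) tests31 (fun _ _ => true)
    [:: 0%N].
Proof. by vm_compute. Qed.

(** By [capped_runs_exists] a dilation puts a longest run first, so one search for each run length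
    covers all cases. *)
Lemma skew_search43 :
  search_skew 43 [:: A43; squares 43] powers3 tests43 capped_runs (iota 1 21).
Proof. by vm_cast_no_check (erefl true). Qed.

Lemma set_search7 : search_sets 7 (moves_to 5 B7) 1 A7 0.
Proof. by vm_compute. Qed.

(** The anchor is 2 because the difference 1 occurs three times in [A13] and hence never in B. *)
Lemma set_search13 : search_sets 13 (moves_to 11 B13) 3 A13 2.
Proof. by vm_compute. Qed.

Lemma set_search21 : search_sets 21 (moves_to 19 B21) 6 A21 1.
Proof. by vm_compute. Qed.

Lemma set_search31 : search_sets 31 (moves_to 29 B31) 10 A31 1.
Proof. by vm_cast_no_check (erefl true). Qed.

(** * Skew sets without a partner *)

Lemma set_search31_squares :
  search_sets 31 (fun _ => false) 10 (squares 31) 1.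
Proof. by vm_cast_no_check (erefl true). Qed.

(** The squares form a (31, 15, 7) difference set, so B would be a cyclic (31, 10, 3) difference
    set; the search reaches no leaf. *)
Lemma no_partner_squares31 (B : {set 'Z_31}) :
  ~ skew_pair 10 (setof 31 (squares 31)) B.
Proof.
move=> sp.
have uL : uniq (squares 31) by vm_compute.
have aL : all (fun i => i < 31)%N (squares 31) by vm_compute.
have Bd : (0 < diff_count B 1%:R)%N.
  by rewrite (diff_count_partner uL aL sp).
by have [t []] := search_sets_sound (v' := 29) isT set_search31_squares uL aL
  isT isT sp Bd.
Qed.

(** Every nonzero difference occurs 10 times among the squares, which leaves 5 for B; as |B| = 15,
    all counts of B are odd. Moreover 2^7 = 128 = -1 modulo 43. *)
Lemma no_partner_squares43 (B : {set 'Z_43}) :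
  ~ skew_pair 15 (setof 43 (squares 43)) B.
Proof.
move=> sp; have [_ B15 _] := sp.
have odd_diff d : odd (diff_count B d).
  have [->|d0] := eqVneq d 0; first by rewrite diff_count0 B15.
  have uL : uniq (squares 43) by vm_compute.
  have aL : all (fun i => i < 43)%N (squares 43) by vm_compute.
  rewrite -[d]natr_Zp (diff_count_partner uL aL sp).
  - have al : all (fun n => odd (partner_count 43 15 (squares 43) n)) 
    (iota 1 42) by vm_compute.
    apply: (allP al); rewrite mem_iota lt0n; apply/andP; split; first by [].
    exact: ltn_ord.
  - by rewrite lt0n; apply/andP; split=> //; exact: ltn_ord.
have [b bB] : exists b, b \in B by apply/set0Pn; rewrite -card_gt0 B15.
have two7 : (2 ^ 7)%:R = -1 :> 'Z_43 by apply/eqP; vm_compute.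
have BT := self_conjugate_full (a := 7) isT two7 odd_diff bB.
by move: B15; rewrite BT cardsT card_ord.
Qed.

(* 39301 is a prime congruent to -1 modulo 43; it divides
   [|B(z)|^2 = 21 - |A(z)|^2] at a place of the real subfield of [Q(z)], [z] a
   primitive 43rd root of unity, but the square of that place does not.  The
   integer [lucas_t] represents [z + 1/z] modulo [39301 ^ 2], and the Lucas
   sequences below are [z^n + z^-n] and [(z^n - z^-n) / (z - 1/z)]. *)
Section Constants.
Local Open Scope Z_scope.
Definition inert_p : Z := 39301.
Definition lucas_t : Z := 192917985.
Definition half_norm_cofactor : Z := 3586328.
End Constants.

Fixpoint lucas (n : nat) (x y : Z) : seq Z :=
  if n is n'.+1 then
    x :: lucas n' y (Z.modulo (lucas_t * y - x)%R (inert_p * inert_p)%R)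
  else [::].

Definition lucas_c := lucas 43 2 lucas_t.
Definition lucas_s := lucas 43 0 1.
Definition lucas_d : Z := lucas_t * lucas_t - 4.

Lemma lucas_addition_law :
  addition_law 41 (inert_p * inert_p) lucas_d lucas_c lucas_s.
Proof. by vm_compute. Qed.

Lemma inert_p_prime : Znumtheory.prime inert_p.
(* Trial division runs up to 198, and 199^2 exceeds 39301. *)
Proof. by apply: (@prime_belowP 197); vm_compute. Qed.

(** 43 * 457 = 19651 = (39301 + 1) / 2, so all residues are covered up to sign. *)
Lemma lucas_d_nonsquare : nonsquare_mod 43 457 inert_p lucas_d.
Proof. by vm_cast_no_check (erefl true). Qed.

Lemma no_partner_A43 (B : {set 'Z_43}) : ~ skew_pair 15 (setof 43 A43) B.
Proof.
move=> sp; have [_ B15 _] := sp.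
have uL : uniq A43 by [].
have aL : all (fun i => i < 43)%N A43 by [].
have pp_gt0 : 0 < inert_p * inert_p by [].
have [a [b]] := norm_form_profile B pp_gt0 lucas_addition_law.
pose F n := (if n == 0%N then 15%N else partner_count 43 15 A43 n)%:R
  * nth 0 lucas_c n.
have -> : \sum_(d : 'Z_43) (diff_count B d)%:R * nth 0 lucas_c d
    = zsum [seq F i | i <- iota 0 43].
  rewrite -sum_Zp; apply: eq_bigr => d _; rewrite /F.
  have [d0|d0] := eqVneq d 0; first by rewrite d0 diff_count0 B15.
  rewrite (_ : (d == 0 :> nat) = false); last by apply/negbTE.
  rewrite -[d in diff_count B d]natr_Zp.
  rewrite (diff_count_partner uL aL sp) //.
  by rewrite lt0n; apply/andP; split=> //; exact: ltn_ord.
(* With reduced representatives the sum is exactly p times a cofactor whose double p does not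
   divide, against [norm_form_dvd]. *)
have -> : zsum [seq F i | i <- iota 0 43] = inert_p * half_norm_cofactor by
  vm_compute.
have p_gt0 : 0 < inert_p by vm_compute.
have p_lt : inert_p < 2 * (Z.of_nat 43 * Z.of_nat 457) by vm_compute.
have nsq x r := @nonsquare_modP 43 457 _ _ x r p_gt0 p_lt lucas_d_nonsquare.
by move=> /(norm_form_dvd inert_p_prime nsq)[r];
  rewrite /inert_p /half_norm_cofactor; lia.
Qed.

(** * Classification order by order *)

Section Classification.
Variables (v' k : nat).
Local Notation v := v'.+2.
Implicit Types (A B : {set 'Z_v}).

Lemma skew_search_sound A B canon tests :
    search_skew v canon (iota 1 v./2) tests (fun _ _ => true) [:: 0%N] ->
    half_system v (iota 1 v./2) -> all (skew_seq v) canon -> odd v ->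
    skew_pair k A B ->
  exists2 L, L \in canon & exists2 B',
    skew_pair k (setof v L) B' & sds_equiv (A, B) (setof v L, B').
Proof.
move=> se hs sk vo sp.
have [|m [L [mv cm Lc mA]]] := search_skew_sound vo se hs sk sp;
  first by exists 0%N.
exists L => //; exists (dilate m B); rewrite -mA.
  exact: skew_pair_dilate.
exact: sds_equiv_dilate.
Qed.

Definition reaches A B (L L' : seq nat) : Prop :=
  sds_equiv (A, B) (setof v L, setof v L') /\
  skew_pair k (setof v L) (setof v L').

End Classification.

Lemma skew_pair3 (A B : {set 'Z_3}) : skew_pair 0 A B -> reaches 0 A B A3 [::].
Proof.
move=> sp; have [L] := skew_search_sound skew_search3 isT isT isT sp.
rewrite mem_seq1 => /eqP-> [B' sp' eq1].
have B'0 : B' = setof 3 [::].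
  have [_ B'k _] := sp'; transitivity (set0 : {set 'Z_3}).
    by apply/eqP; rewrite -cards_eq0 B'k.
  by apply/setP => x; rewrite !inE.
by rewrite B'0 in sp' eq1.
Qed.

Lemma skew_pair7 (A B : {set 'Z_7}) :
  skew_pair 1 A B -> reaches 1 A B A7 B7.
Proof.
move=> sp; have [L] := skew_search_sound skew_search7 isT isT isT sp.
rewrite mem_seq1 => /eqP-> [B' sp' eq1].
have [|eq2 sp2] :=
  sds_equiv_search (v' := 5) isT set_search7 isT isT isT isT isT erefl isT sp'.
  by have [_ Bk _] := sp'; rewrite diff_count0 Bk.
by split=> //; exact: rst_trans eq1 eq2.
Qed.

Lemma skew_pair13 (A B : {set 'Z_13}) :
  skew_pair 3 A B -> reaches 3 A B A13 B13.
Proof.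
move=> sp; have [L] := skew_search_sound skew_search13 isT isT isT sp.
rewrite mem_seq1 => /eqP-> [B' sp' eq1].
have [|eq2 sp2] :=
  sds_equiv_search (v' := 11) isT set_search13 isT isT isT isT isT erefl isT
    sp'.
  by rewrite (@diff_count_partner 11 3 A13 B' 2 isT isT sp' isT).
by split=> //; exact: rst_trans eq1 eq2.
Qed.

Lemma skew_pair21 (A B : {set 'Z_21}) :
  skew_pair 6 A B -> reaches 6 A B A21 B21.
Proof.
move=> sp; have [L] := skew_search_sound skew_search21 isT isT isT sp.
rewrite mem_seq1 => /eqP-> [B' sp' eq1].
have [|eq2 sp2] :=
  sds_equiv_search (v' := 19) isT set_search21 isT isT isT isT isT erefl isT
    sp'.
  by rewrite (@diff_count_partner 19 6 A21 B' 1 isT isT sp' isT).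
by split=> //; exact: rst_trans eq1 eq2.
Qed.

Lemma skew_pair31 (A B : {set 'Z_31}) :
  skew_pair 10 A B -> reaches 10 A B A31 B31.
Proof.
move=> sp; have [L] := skew_search_sound skew_search31 isT isT isT sp.
rewrite mem_seq2 => /orP[]/eqP-> [B' sp' eq1];
  last by case: (no_partner_squares31 sp').
have [|eq2 sp2] :=
  sds_equiv_search (v' := 29) isT set_search31 isT isT isT isT isT erefl isT
    sp'.
  by rewrite (@diff_count_partner 29 10 A31 B' 1 isT isT sp' isT).
by split=> //; exact: rst_trans eq1 eq2.
Qed.

Lemma skew_pair43 (A B : {set 'Z_43}) : ~ skew_pair 15 A B.
Proof.
move=> sp; have [m cm runs] := capped_runs_exists sp.
have sp' := skew_pair_dilate cm sp.
have hs : half_system 43 powers3 by vm_compute.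
have sk : all (skew_seq 43) [:: A43; squares 43] by vm_compute.
have [n [L [nv cn Lc nA]]] :=
  search_skew_sound (v' := 41) isT skew_search43 hs sk sp' runs.
have := skew_pair_dilate cn sp'; rewrite nA; move: Lc.
rewrite mem_seq2 => /orP[]/eqP->; [exact: no_partner_A43|].
exact: no_partner_squares43.
Qed.

Ltac setof_enum :=
  congr sds_design; apply/setP; intros [n ltn]; rewrite !inE;
  repeat first [by revert ltn | destruct n as [|n]; [by vm_compute|]].

Lemma D6E : D6 = sds_design (setof 3 A3) (setof 3 [::]).
Proof. setof_enum. Qed.

Lemma D14E : D14 = sds_design (setof 7 A7) (setof 7 B7).
Proof. setof_enum. Qed.

Lemma D26E : D26 = sds_design (setof 13 A13) (setof 13 B13).
Proof. setof_enum. Qed.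

Lemma D42E : D42 = sds_design (setof 21 A21) (setof 21 B21).
Proof. setof_enum. Qed.

Lemma D62E : D62 = sds_design (setof 31 A31) (setof 31 B31).
Proof. setof_enum. Qed.

(** With j = (v - 1) / 2 - k, [skew_pair_params] gives k = (j^2 - j) / 2 and v = j^2 + j + 1, so v
    <= 55 leaves j = 1, ..., 6. *)
Lemma skew_pair_small v' k (A B : {set 'Z_v'.+2}) :
    odd v'.+2 -> (v'.+2 <= 55)%N -> (k <= v'.+2./2)%N -> skew_pair k A B ->
  (v', k) \in [:: (1, 0); (5, 1); (11, 3); (19, 6); (29, 10); (41, 15)]%N.
Proof.
move=> vo v55 kh sp; have := skew_pair_params vo sp.
have vE : (v' + 2 = (v'.+2./2).*2 + 1)%N.
  by rewrite addn2 -[LHS]odd_double_half vo addnC.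
move: kh vE; move: (v'.+2./2)%N => h kh vE.
have [j hE] : exists j, h = (k + j)%N by exists (h - k)%N; rewrite subnKC.
rewrite hE addKn (_ : (k - (k + j) = 0)%N); last by lia.
rewrite exp0n // addn0 => jE.
have j8 : (j < 8)%N by nia.
have kE : k = ((j * j - j) %/ 2)%N by lia.
have v'E : v' = ((k + j).*2 - 1)%N by lia.
rewrite v'E kE; move: j8 vE jE hE {kE v'E}.
by do 8 (case: j => [|j]; first by rewrite //; lia).
Qed.

Theorem corollary10 (n v : nat) (R1 R2 : 'M[int]_v)
    (hnv : n = (2 * v)%N) (hn4 : (n = 2 %[mod 4])%N)
    (hn2 : (2 < n)%N) (hn110 : (n <= 110)%N)
    (hD : circulant_Dopt R1 R2) (hskew : skew_symmetric (Xmx R1 R2)) :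
  design_equiv (Xmx R1 R2) D6 \/ design_equiv (Xmx R1 R2) D14 \/
  design_equiv (Xmx R1 R2) D26 \/ design_equiv (Xmx R1 R2) D42 \/
  design_equiv (Xmx R1 R2) D62.
Proof.
have vo : odd v by lia.
have v55 : (v <= 55)%N by lia.
have v2 : (1 < v)%N by lia.
case: v R1 R2 hnv hD hskew vo v55 v2 => [|[|v']] // R1 R2 _ hD hskew vo v55 _.
have [[p1 p2] [c1 c2] _] := hD.
move: hD hskew; rewrite (circulant_circ_mx p1 c1) (circulant_circ_mx p2 c2).
move: (neg_set R1) (neg_set R2) => A B hD hskew.
have skA := skew_circ_mx hskew.
have sp : skew_pair #|B| A B by split=> //; exact: design_diff_count vo hD skA.
(* Complementing B if necessary makes k at most (v - 1) / 2. *)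
have [k [C [kh spC ABC]]] : exists k C, [/\ (k <= v'.+2./2)%N,
    skew_pair k A C & sds_equiv (A, B) (A, C)].
  have [le_h|gt_h] := leqP #|B| v'.+2./2.
    by exists #|B|, B; split=> //; exact: rst_refl.
  exists (v'.+2 - #|B|)%N, (~: B); split; first by lia.
    exact: skew_pair_compl.
  exact/rst_step/SdsComplR.
have dBC : Dopt_sds A B by exact: skew_pair_Dopt sp.
have to_D L L' : reaches k A C L L' ->
    design_equiv (sds_design A B) (sds_design (setof v'.+2 L) (setof v'.+2 L')).
  move=> [eqC spL]; apply: (DesignEquiv dBC (skew_pair_Dopt vo spL)).
  exact: rst_trans ABC eqC.
rewrite -/(sds_design A B).
have := skew_pair_small vo v55 kh spC; rewrite !inE !xpair_eqE.
rewrite D6E D14E D26E D42E D62E.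
case/orP=> [/andP[/eqP ev /eqP ek]|]; first by subst v' k; left;
  exact/to_D/skew_pair3.
case/orP=> [/andP[/eqP ev /eqP ek]|].
  by subst v' k; right; left; exact/to_D/skew_pair7.
case/orP=> [/andP[/eqP ev /eqP ek]|].
  by subst v' k; do 2 right; left; exact/to_D/skew_pair13.
case/orP=> [/andP[/eqP ev /eqP ek]|].
  by subst v' k; do 3 right; left; exact/to_D/skew_pair21.
case/orP=> [/andP[/eqP ev /eqP ek]|/andP[/eqP ev /eqP ek]].
  by subst v' k; do 4 right; exact/to_D/skew_pair31.
by subst v' k; case: (skew_pair43 spC).
Qed.
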